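(* Let $\mathbb P$ be the pseudoarc. Then $C(\mathbb P)$ is the prime model of its theory; that is, for every unital C$^*$-algebra $B$ that is elementarily equivalent to $C(\mathbb P)$ (in the continuous-logic language of unital C$^*$-algebras), there is an elementary embedding of $C(\mathbb P)$ into $B$.
   Context: A continuum is a connected compact Hausdorff space. The pseudoarc $\mathbb P$ is the unique (nondegenerate) metrizable continuum that is hereditarily indecomposable (no subcontinuum is the union of two proper subcontinua) and chainable (every finite open cover has a finite open refinement $U_1,\dots,U_n$ with $U_i\cap U_j\neq\emptyset$ iff $|i-j|\le 1$). Unital C$^*$-algebras are regarded as structures in a many-sorted continuous language: for each $k\ge1$ a sort for the closed operator-norm ball of radius $k$ with metric $\|x-y\|$, function symbols for the $*$-algebra operations, constants $0,1$ and inclusion maps between balls. Elementary equivalence and elementary embeddings are in the sense of (finitary) continuous first-order logic. *)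

(* Defs.v *)
From HB Require Import structures.
From mathcomp Require Import all_boot all_order all_algebra.
From mathcomp Require Import all_classical all_reals all_analysis.
From mathcomp Require Import complex lra.


Set Implicit Arguments.
Unset Strict Implicit.
Unset Printing Implicit Defensive.

Import Order.TTheory GRing.Theory Num.Theory.
Import numFieldNormedType.Exports.
Import ComplexField ComplexField.Normc.

Local Open Scope classical_set_scope.
Local Open Scope complex_scope.
Local Open Scope ring_scope.

(* The base point only records that a continuum is nonempty. *)
HB.mixin Record isContinuum T & PointedTopological T := {
  continuum_compact : compact [set: T];
  continuum_hausdorff : hausdorff_space T;
  continuum_connected : connected [set: T]
}.

#[short(type="continuumType")]
HB.structure Definition Continuum := {T of PointedTopological T & isContinuum T}.

Definition metrizable (R : realType) (T : topologicalType) : Prop :=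
  exists d : T -> T -> R,
    [/\ forall x y, d x y = 0 <-> x = y,
        forall x y, d x y = d y x,
        forall x y z, d x z <= d x y + d y z
      & forall x (A : set T),
          nbhs x A <-> exists2 e : R, 0 < e & [set y | d x y < e] `<=` A].

Definition subcontinuum (T : topologicalType) (K : set T) : Prop :=
  [/\ K !=set0, compact K & connected K].

Definition hereditarily_indecomposable (T : topologicalType) : Prop :=
  forall K A B : set T,
    subcontinuum K -> subcontinuum A -> subcontinuum B ->
    K = A `|` B -> A = K \/ B = K.

Definition chainable (T : topologicalType) : Prop :=
  forall (m : nat) (V : 'I_m -> set T),
    (forall i, open (V i)) -> \bigcup_i V i = [set: T] ->
  exists (n : nat) (U : 'I_n -> set T),
    [/\ forall i, open (U i),
        \bigcup_i U i = [set: T],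
        forall i, exists j, U i `<=` V j
      & forall i j, U i `&` U j !=set0 <-> (i <= j.+1)%N /\ (j <= i.+1)%N].

Definition pseudoarc (R : realType) (P : continuumType) : Prop :=
  [/\ metrizable R P, exists x y : P, x <> y,
      hereditarily_indecomposable P & chainable P].

(* The norm is a field of the mixin, and completeness is stated with Cauchy sequences,
   because HB does not allow a join of rings and normed modules to be declared after
   [numDomainType]. Algebras are nonzero by definition of [algType]; this excludes no
   algebra elementarily equivalent to a nonzero one. *)
HB.mixin Record isCStar (R : realType) A & GRing.Algebra R[i] A := {
  cnorm : A -> R;
  adj : A -> A;
  cnormD : forall x y, cnorm (x + y) <= cnorm x + cnorm y;
  cnormZ : forall (c : R[i]) x, cnorm (c *: x) = normc c * cnorm x;
  cnorm0_eq0 : forall x, cnorm x = 0 -> x = 0;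
  cnormM : forall x y, cnorm (x * y) <= cnorm x * cnorm y;
  cnorm_complete : forall u : nat -> A,
    (forall e : R, 0 < e -> exists N, forall m n,
        (N <= m)%N -> (N <= n)%N -> cnorm (u m - u n) < e) ->
    exists l, forall e : R, 0 < e -> exists N, forall n,
        (N <= n)%N -> cnorm (u n - l) < e;
  adjK : involutive adj;
  adjD : forall x y, adj (x + y) = adj x + adj y;
  adjZ : forall (c : R[i]) x, adj (c *: x) = conjc c *: adj x;
  adjM : forall x y, adj (x * y) = adj y * adj x;
  cnorm_adjM : forall x, cnorm (adj x * x) = cnorm x ^+ 2
}.

#[short(type="cstarType")]
HB.structure Definition CStar (R : realType) :=
  {A of GRing.Algebra R[i] A & isCStar R A}.

Section CStarTheory.
Context {R : realType} {A : cstarType R}.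
Implicit Types x y : A.

Lemma cnorm0 : cnorm (0 : A) = 0.
Proof. by rewrite -(scale0r (0 : A)) cnormZ Normc.normc0 mul0r. Qed.

Lemma cnormN x : cnorm (- x) = cnorm x.
Proof. by rewrite -scaleN1r cnormZ normcN Normc.normc1 mul1r. Qed.

Lemma cnorm_ge0 x : 0 <= cnorm x.
Proof.
have := cnormD x (- x); rewrite subrr cnorm0 cnormN -mulr2n.
by rewrite pmulrn_lge0.
Qed.

Lemma cnorm_adj x : cnorm (adj x) = cnorm x.
Proof.
have le_adj y : cnorm y <= cnorm (adj y).
  have [->|y0] := eqVneq (cnorm y) 0; first exact: cnorm_ge0.
  have y_gt0 : 0 < cnorm y by rewrite lt_neqAle eq_sym y0 cnorm_ge0.
  by rewrite -(ler_pM2r y_gt0) -expr2 -cnorm_adjM cnormM.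
by apply/le_anti; rewrite le_adj andbT -{2}(adjK x) le_adj.
Qed.

Lemma adj1 : adj (1 : A) = 1.
Proof. by rewrite -[LHS]mulr1 -{2}(adjK 1) -adjM mulr1 adjK. Qed.

Lemma cnorm1 : cnorm (1 : A) = 1.
Proof.
have n1 : cnorm (1 : A) != 0.
  by apply/eqP => /cnorm0_eq0/eqP; rewrite oner_eq0.
by apply: (mulfI n1); rewrite mulr1 -expr2 -cnorm_adjM adj1 mulr1.
Qed.

End CStarTheory.

Section ComplexModulus.
Context {R : realType}.
Implicit Types z w : R[i].

Lemma normcD z w : normc (z + w) <= normc z + normc w.
Proof. exact: le_normcD. Qed.

Lemma normc_ge0 z : 0 <= normc z.
Proof. by case: z => a b; exact: sqrtr_ge0. Qed.

Lemma normc_subC z w : normc (z - w) = normc (w - z).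
Proof. by rewrite -normcN opprB. Qed.

Lemma normc_conjc z : normc (conjc z) = normc z.
Proof. by case: z => a b /=; rewrite sqrrN. Qed.

Lemma normc_conjcB z w : normc (conjc z - conjc w) = normc (z - w).
Proof. by rewrite -(normc_conjc (z - w)) raddfB. Qed.

Lemma normc_Re z : `|complex.Re z| <= normc z.
Proof.
by case: z => a b /=; rewrite -sqrtr_sqr ler_wsqrtr// lerDl sqr_ge0.
Qed.

Lemma normc_Im z : `|complex.Im z| <= normc z.
Proof.
by case: z => a b /=; rewrite -sqrtr_sqr ler_wsqrtr// lerDr sqr_ge0.
Qed.

Lemma normc_le z : normc z <= `|complex.Re z| + `|complex.Im z|.
Proof.
have -> : z = (complex.Re z)%:C + 'i * (complex.Im z)%:C.
  by rewrite [LHS]complexE.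
apply: (le_trans (normcD _ _)); rewrite Normc.normcM.
case: z => a b /=; simpc.
by rewrite !expr0n/= expr1n !(addr0, add0r) sqrtr1 mul1r !sqrtr_sqr.
Qed.

Lemma normc_dist z w : `|normc z - normc w| <= normc (z - w).
Proof.
rewrite ler_norml; apply/andP; split.
  by rewrite lerNl opprB lerBlDr normc_subC -{1}(subrK z w) normcD.
by rewrite lerBlDr -{1}(subrK w z) normcD.
Qed.

Lemma continuous_normcP (T : topologicalType) (f : T -> R[i]^o) :
  continuous f <->
  forall x (e : R), 0 < e -> \forall y \near x, normc (f x - f y) < e.
Proof.
split=> [fc x e e0|fc x].
  have /cvgrPdist_lt := fc x; move=> /(_ e%:C); rewrite ltcR => /(_ e0).
  by apply: filterS => y; rewrite -ltcR.
apply/cvgrPdist_lt => e e0.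
have eE : e = (complex.Re e)%:C.
  by rewrite RRe_real// gtr0_real.
move: e0; rewrite eE ltcR => e0.
by apply: filterS (fc x _ e0) => y; rewrite -ltcR.
Qed.

Lemma real_cauchy_seq (u : nat -> R) :
  (forall e : R, 0 < e -> exists N, forall m n,
     (N <= m)%N -> (N <= n)%N -> `|u m - u n| < e) ->
  exists l, forall e : R, 0 < e -> exists N, forall n,
     (N <= n)%N -> `|u n - l| < e.
Proof.
move=> uc.
have /cvg_ex[l ul] : cvg (u @ \oo).
  apply/cauchy_cvgP/cauchy_exP => e e0; have [N uN] := uc _ e0.
  by exists (u N); exists N => // n /= Nn; exact: uN.
exists l => e e0; move/cvgrPdist_lt: ul => /(_ _ e0)[N _ uN].
by exists N => n Nn; rewrite distrC; exact: uN.
Qed.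

Lemma complex_cauchy_seq (u : nat -> R[i]) :
  (forall e : R, 0 < e -> exists N, forall m n,
     (N <= m)%N -> (N <= n)%N -> normc (u m - u n) < e) ->
  exists l, forall e : R, 0 < e -> exists N, forall n,
     (N <= n)%N -> normc (u n - l) < e.
Proof.
move=> uc.
have [|a ua] := @real_cauchy_seq ((fun z : R[i] => complex.Re z) \o u).
  move=> e /uc[N uN]; exists N => m n Nm Nn; rewrite -raddfB.
  by apply: le_lt_trans (uN _ _ Nm Nn); exact: normc_Re.
have [|b ub] := @real_cauchy_seq ((fun z : R[i] => complex.Im z) \o u).
  move=> e /uc[N uN]; exists N => m n Nm Nn; rewrite -raddfB.
  by apply: le_lt_trans (uN _ _ Nm Nn); exact: normc_Im.
exists (a +i* b) => e e0.
have e20 : 0 < e / 2 by rewrite divr_gt0.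
have [[N uN] [M uM]] := (ua _ e20, ub _ e20).
exists (maxn N M) => n; rewrite geq_max => /andP[Nn Mn].
apply: (le_lt_trans (normc_le _)); rewrite (splitr e).
move: (uN n Nn) (uM n Mn) => /=.
by case: (u n) => c d /= ? ?; rewrite ltrD.
Qed.

End ComplexModulus.

(* [R[i]^o] is the complex field with the topology of its modulus. *)
Definition contC (R : realType) (P : continuumType) : Type := continuousType P R[i]^o.

Section ContC.
Context (R : realType) (P : continuumType).
Local Notation CP := (contC R P).
Implicit Types (f g h : CP) (x : P).

HB.instance Definition _ := Choice.on CP.
Definition contC_fun f : P -> R[i] := f.
Local Coercion contC_fun : contC >-> Funclass.

Definition mkC (f : P -> R[i]^o) (fc : continuous f) : CP :=
  mkcts fc : continuousType P R[i]^o.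

Lemma contC_eq f g : (forall x, f x = g x) -> f = g.
Proof. by move=> fg; apply/continuousEP. Qed.

Lemma contC_cts f : continuous (f : P -> R[i]^o). Proof. exact: cts_fun. Qed.

Let zero_cts : continuous (fun _ : P => 0 : R[i]^o).
Proof. by move=> x; exact: cvg_cst. Qed.
Let one_cts : continuous (fun _ : P => 1 : R[i]^o).
Proof. by move=> x; exact: cvg_cst. Qed.
Let opp_cts f : continuous (fun x => - f x : R[i]^o).
Proof. by move=> x; apply: cvgN; exact: contC_cts. Qed.
Let add_cts f g : continuous (fun x => f x + g x : R[i]^o).
Proof. by move=> x; apply: cvgD; exact: contC_cts. Qed.
Let mul_cts f g : continuous (fun x => f x * g x : R[i]^o).
Proof. by move=> x; apply: cvgM; exact: contC_cts. Qed.
Let scale_cts (c : R[i]) f : continuous (fun x => c * f x : R[i]^o).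
Proof. by move=> x; apply: cvgM; [exact: cvg_cst | exact: contC_cts]. Qed.
Let adj_cts f : continuous (fun x => conjc (f x) : R[i]^o).
Proof.
apply/continuous_normcP => x e e0.
have /continuous_normcP/(_ x _ e0) := @contC_cts f.
by apply: filterS => y h; exact: (eq_ind_r (fun t => t < e) h (normc_conjcB _ _)).
Qed.

Definition zeroC : CP := mkC zero_cts.
Definition oneC : CP := mkC one_cts.
Definition oppC f : CP := mkC (@opp_cts f).
Definition addC f g : CP := mkC (@add_cts f g).
Definition mulC f g : CP := mkC (@mul_cts f g).
Definition scaleC (c : R[i]) f : CP := mkC (@scale_cts c f).
Definition conjC f : CP := mkC (@adj_cts f).

Let addCA : associative addC.
Proof. by move=> f g h; apply: contC_eq => x; exact: addrA. Qed.
Let addCC : commutative addC.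
Proof. by move=> f g; apply: contC_eq => x; exact: addrC. Qed.
Let add0C : left_id zeroC addC.
Proof. by move=> f; apply: contC_eq => x; exact: add0r. Qed.
Let addNC : left_inverse zeroC oppC addC.
Proof. by move=> f; apply: contC_eq => x; exact: addNr. Qed.

HB.instance Definition _ := GRing.isZmodule.Build CP addCA addCC add0C addNC.

Let mulCA : associative mulC.
Proof. by move=> f g h; apply: contC_eq => x; exact: mulrA. Qed.
Let mulCC : commutative mulC.
Proof. by move=> f g; apply: contC_eq => x; exact: mulrC. Qed.
Let mul1C : left_id oneC mulC.
Proof. by move=> f; apply: contC_eq => x; exact: mul1r. Qed.
Let mulCDl : left_distributive mulC addC.
Proof. by move=> f g h; apply: contC_eq => x; exact: mulrDl. Qed.
Let oneC_neq0 : oneC != 0.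
Proof.
apply/eqP => /(congr1 (fun f : CP => f point)) /eqP.
by rewrite [_ == _]oner_eq0.
Qed.

HB.instance Definition _ :=
  GRing.Zmodule_isComNzRing.Build CP mulCA mulCC mul1C mulCDl oneC_neq0.

Let scaleCA a b f : scaleC a (scaleC b f) = scaleC (a * b) f.
Proof. by apply: contC_eq => x; exact: mulrA. Qed.
Let scale1C : left_id 1 scaleC.
Proof. by move=> f; apply: contC_eq => x; exact: mul1r. Qed.
Let scaleCDr : right_distributive scaleC +%R.
Proof. by move=> a f g; apply: contC_eq => x; exact: mulrDr. Qed.
Let scaleCDl f : {morph scaleC^~ f : a b / a + b}.
Proof. by move=> a b; apply: contC_eq => x; exact: mulrDl. Qed.

HB.instance Definition _ := GRing.Zmodule_isLmodule.Build R[i] CP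
  scaleCA scale1C scaleCDr scaleCDl.

Let scaleCAl (a : R[i]) f g : a *: (f * g) = a *: f * g.
Proof. by apply: contC_eq => x; exact: mulrA. Qed.

HB.instance Definition _ := GRing.Lmodule_isLalgebra.Build R[i] CP scaleCAl.

HB.instance Definition _ := GRing.Lalgebra_isComAlgebra.Build R[i] CP.

Definition supnorm f : R := sup [set normc (f x) | x in [set: P]].

Lemma supnorm_has_sup f : has_sup [set normc (f x) | x in [set: P]].
Proof.
split; first by exists (normc (f point)), point.
have fc : continuous (fun x => normc (f x)).
  move=> x; apply/cvgrPdist_lt => e e0.
  have /continuous_normcP/(_ x _ e0) := @contC_cts f.
  apply: filterS => y; apply: le_lt_trans.
  exact: normc_dist.
have : compact [set normc (f x) | x in [set: P]].
  apply: continuous_compact; last exact: continuum_compact.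
  exact: continuous_subspaceT.
move=> /compact_bounded[M [_ /(_ (M + 1))]].
rewrite ltrDl => /(_ ltr01) fM.
by exists (M + 1) => _ [x _ <-]; rewrite (le_trans (ler_norm _))// fM//; exists x.
Qed.

Lemma supnorm_ub f x : normc (f x) <= supnorm f.
Proof.
by apply: sup_upper_bound; [exact: supnorm_has_sup | exists x].
Qed.

Lemma supnorm_le f (M : R) : (forall x, normc (f x) <= M) -> supnorm f <= M.
Proof.
move=> fM; apply: ge_sup; first by case: (supnorm_has_sup f).
by move=> _ [x _ <-].
Qed.

Lemma supnorm_ge0 f : 0 <= supnorm f.
Proof. exact: le_trans (normc_ge0 _) (supnorm_ub f point). Qed.

Let supnormD f g : supnorm (f + g) <= supnorm f + supnorm g.
Proof.
apply: supnorm_le => x; apply: (le_trans (normcD (f x) (g x))).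
by rewrite lerD// supnorm_ub.
Qed.

Let supnormZle (c : R[i]) f : supnorm (c *: f) <= normc c * supnorm f.
Proof.
apply: supnorm_le => x; rewrite [normc _](Normc.normcM c (f x)).
by rewrite ler_wpM2l ?normc_ge0// supnorm_ub.
Qed.

Let supnormZ (c : R[i]) f : supnorm (c *: f) = normc c * supnorm f.
Proof.
apply/le_anti; rewrite supnormZle/=.
have [->|c0] := eqVneq c 0; first by rewrite Normc.normc0 mul0r supnorm_ge0.
have nc0 : 0 < normc c.
  rewrite lt_neqAle normc_ge0 andbT eq_sym; apply: contra c0 => /eqP.
  by move=> /Normc.eq0_normc ->.
rewrite mulrC -ler_pdivlMr// mulrC -Normc.normcV.
by rewrite -[X in supnorm X <= _]scale1r -(mulVf c0) -scalerA supnormZle.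
Qed.

Let supnorm0_eq0 f : supnorm f = 0 -> f = 0.
Proof.
move=> f0; apply: contC_eq => x; apply: Normc.eq0_normc.
by apply/le_anti; rewrite normc_ge0 -f0 supnorm_ub.
Qed.

Let supnormM f g : supnorm (f * g) <= supnorm f * supnorm g.
Proof.
apply: supnorm_le => x; rewrite [normc _](Normc.normcM (f x) (g x)).
by rewrite ler_pM ?normc_ge0 ?supnorm_ub.
Qed.

Let supnorm_complete (u : nat -> CP) :
  (forall e : R, 0 < e -> exists N, forall m n,
      (N <= m)%N -> (N <= n)%N -> supnorm (u m - u n) < e) ->
  exists l, forall e : R, 0 < e -> exists N, forall n,
      (N <= n)%N -> supnorm (u n - l) < e.
Proof.
move=> uc.
have uxc x : exists l, forall e : R, 0 < e -> exists N, forall n,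
     (N <= n)%N -> normc (u n x - l) < e.
  apply: complex_cauchy_seq => e /uc[N uN]; exists N => m n Nm Nn.
  by apply: le_lt_trans (uN _ _ Nm Nn); exact: (supnorm_ub (u m - u n) x).
have [g ug] := choice uxc.
have unif (e : R) : 0 < e -> exists N, forall n x,
    (N <= n)%N -> normc (u n x - g x) <= e.
  move=> /uc[N uN]; exists N => n x Nn; apply/ler_addgt0Pl => d d0.
  have [M uM] := ug x _ d0.
  have := uM (maxn N M) (leq_maxr _ _).
  have := uN n (maxn N M) Nn (leq_maxl _ _).
  set k := maxn N M => h1 h2.
  rewrite -(subrK (u k x) (u n x)) -addrA addrC.
  apply: (le_trans (normcD _ _)); rewrite lerD// ?(ltW h2)//.
  exact: le_trans (supnorm_ub (u n - u k) x) (ltW h1).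
have gc : continuous (g : P -> R[i]^o).
  apply/continuous_normcP => x e e0.
  have e40 : 0 < e / 4 by rewrite divr_gt0.
  have e20 : 0 < e / 2 by rewrite divr_gt0.
  have [N uN] := unif _ e40.
  have /continuous_normcP/(_ x _ e20) := @contC_cts (u N).
  apply: filterS => y uxy.
  have -> : g x - g y = (g x - u N x) + (u N x - u N y) + (u N y - g y).
    by rewrite !addrA !subrK.
  apply: (le_lt_trans (normcD _ _)).
  apply: (@le_lt_trans _ _ (e / 4 + normc (u N x - u N y) + e / 4)).
    rewrite lerD ?uN// (le_trans (normcD _ _))// lerD2r normc_subC.
    exact: uN.
  by rewrite addrAC -ltrBrDl (lt_le_trans uxy)//; lra.
exists (mkC gc) => e e0; have e20 : 0 < e / 2 by rewrite divr_gt0.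
have [N uN] := unif _ e20; exists N => n Nn.
apply: (@le_lt_trans _ _ (e / 2)); last by lra.
by apply: supnorm_le => x; exact: uN.
Qed.

Let conjCK : involutive conjC.
Proof. by move=> f; apply: contC_eq => x; exact: conjcK. Qed.

Let conjCD f g : conjC (f + g) = conjC f + conjC g.
Proof. by apply: contC_eq => x; exact: (raddfD (@conjc R)). Qed.

Let conjCZ (c : R[i]) f : conjC (c *: f) = conjc c *: conjC f.
Proof. by apply: contC_eq => x; exact: (rmorphM (@conjc R)). Qed.

Let conjCM f g : conjC (f * g) = conjC g * conjC f.
Proof.
by rewrite mulrC; apply: contC_eq => x; exact: (rmorphM (@conjc R)).
Qed.

Let supnorm_conjCM f : supnorm (conjC f * f) = supnorm f ^+ 2.
Proof.
have fE x : normc ((conjC f * f) x) = normc (f x) ^+ 2.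
  by rewrite [LHS]Normc.normcM normc_conjc expr2.
apply/le_anti/andP; split.
  apply: supnorm_le => x; rewrite fE.
  by rewrite ler_pXn2r ?nnegrE ?normc_ge0 ?supnorm_ge0 ?supnorm_ub.
rewrite -(sqr_sqrtr (supnorm_ge0 (conjC f * f))).
rewrite ler_pXn2r ?nnegrE ?sqrtr_ge0 ?supnorm_ge0//.
apply: supnorm_le => x.
rewrite -(ler_pXn2r (ltn0Sn 1)) ?nnegrE ?normc_ge0 ?sqrtr_ge0//.
by rewrite sqr_sqrtr ?supnorm_ge0// -fE supnorm_ub.
Qed.

HB.instance Definition _ := isCStar.Build R CP
  supnormD supnormZ supnorm0_eq0 supnormM supnorm_complete
  conjCK conjCD conjCZ conjCM supnorm_conjCM.

End ContC.

(* A sort is the radius of a ball. *)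
Record ball_sort := BallSort { radius :> nat; radius_gt0 : (0 < radius)%N }.

Definition sort1 : ball_sort := @BallSort 1 isT.
Definition sort_add (m n : ball_sort) : ball_sort :=
  @BallSort (m + n)%N (ltn_addr n (radius_gt0 m)).
Fact sort_mul_gt0 (m n : ball_sort) : (0 < m * n)%N.
Proof. by rewrite muln_gt0 !radius_gt0. Qed.
Definition sort_mul (m n : ball_sort) : ball_sort := BallSort (sort_mul_gt0 m n).

Definition cball (R : realType) (A : cstarType R) (k : ball_sort) : Type :=
  {x : A | cnorm x <= k%:R}.

(* Contexts are lists of sorts; [var G k] is the type of positions of [k] in [G]. *)
Inductive var : seq ball_sort -> ball_sort -> Type :=
| var0 G k : var (k :: G) k
| varS G j k : var G k -> var (j :: G) k.

(* There is a symbol for multiplication by [c], from the ball of radius [m] to the ball of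
   radius [n], whenever |c| m <= n. *)
Inductive term (R : realType) (G : seq ball_sort) : ball_sort -> Type :=
| tVar k : var G k -> term R G k
| tZero : term R G sort1
| tOne : term R G sort1
| tAdd m n : term R G m -> term R G n -> term R G (sort_add m n)
| tMul m n : term R G m -> term R G n -> term R G (sort_mul m n)
| tScale (c : R[i]) (m n : ball_sort) :
    normc c * m%:R <= n%:R -> term R G m -> term R G n
| tAdj m : term R G m -> term R G m
| tIncl (m n : ball_sort) : (m <= n)%N -> term R G m -> term R G n.

(* The connectives are all the continuous functions from R^n to R. *)
Inductive formula (R : realType) (G : seq ball_sort) : Type :=
| fDist k : term R G k -> term R G k -> formula R G
| fConn n (u : 'rV[R]_n -> R) :
    continuous u -> ('I_n -> formula R G) -> formula R G
| fSup k : formula R (k :: G) -> formula R G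
| fInf k : formula R (k :: G) -> formula R G.

Definition sentence (R : realType) : Type := formula R [::].

Section Semantics.
Context {R : realType} (A : cstarType R).

Definition mkball (k : ball_sort) (x : A) (xk : cnorm x <= k%:R) : cball A k :=
  exist (fun x : A => cnorm x <= k%:R) x xk.

Fixpoint env (G : seq ball_sort) : Type :=
  if G is k :: G' then (cball A k * env G')%type else unit.

Fixpoint lookup G k (v : var G k) : env G -> cball A k :=
  match v in var G k return env G -> cball A k with
  | var0 _ _ => fun r => r.1
  | varS _ _ _ v' => fun r => lookup v' r.2
  end.

Let zero_proof : cnorm (0 : A) <= sort1%:R.
Proof. by rewrite cnorm0. Qed.
Let one_proof : cnorm (1 : A) <= sort1%:R.
Proof. by rewrite cnorm1. Qed.
Let add_proof (m n : ball_sort) (x : cball A m) (y : cball A n) :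
  cnorm (sval x + sval y) <= (sort_add m n)%:R.
Proof.
by rewrite natrD (le_trans (cnormD _ _))// lerD//; [case: x|case: y].
Qed.
Let mul_proof (m n : ball_sort) (x : cball A m) (y : cball A n) :
  cnorm (sval x * sval y) <= (sort_mul m n)%:R.
Proof.
rewrite natrM (le_trans (cnormM _ _))// ler_pM ?cnorm_ge0//.
  by case: x.
by case: y.
Qed.
Let scale_proof (c : R[i]) (m n : ball_sort) (cmn : normc c * m%:R <= n%:R)
  (x : cball A m) : cnorm (c *: sval x) <= n%:R.
Proof.
rewrite cnormZ (le_trans _ cmn)// ler_wpM2l ?normc_ge0//.
by case: x.
Qed.
Let adj_proof (m : ball_sort) (x : cball A m) : cnorm (adj (sval x)) <= m%:R.
Proof. by rewrite cnorm_adj; case: x. Qed.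
Let incl_proof (m n : ball_sort) (mn : (m <= n)%N) (x : cball A m) :
  cnorm (sval x) <= n%:R.
Proof. by case: x => x xm /=; rewrite (le_trans xm)// ler_nat. Qed.

Fixpoint term_val G k (t : term R G k) (r : env G) : cball A k :=
  match t in term _ _ k return cball A k with
  | tVar _ v => lookup v r
  | tZero => mkball zero_proof
  | tOne => mkball one_proof
  | tAdd _ _ t1 t2 => mkball (add_proof (term_val t1 r) (term_val t2 r))
  | tMul _ _ t1 t2 => mkball (mul_proof (term_val t1 r) (term_val t2 r))
  | tScale _ _ _ h t1 => mkball (scale_proof h (term_val t1 r))
  | tAdj _ t1 => mkball (adj_proof (term_val t1 r))
  | tIncl _ _ h t1 => mkball (incl_proof h (term_val t1 r))
  end.

(* [sup] and [inf] are total on [set R], with junk values on unbounded sets; by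
   [formula_val_bounded] below only bounded sets occur here. *)
Fixpoint formula_val G (p : formula R G) : env G -> R :=
  match p with
  | fDist _ t1 t2 => fun r =>
      cnorm (sval (term_val t1 r) - sval (term_val t2 r))
  | fConn _ u _ ps => fun r => u (\row_i formula_val (ps i) r)
  | fSup k q => fun r => sup [set formula_val q (x, r) | x in [set: cball A k]]
  | fInf k q => fun r => inf [set formula_val q (x, r) | x in [set: cball A k]]
  end.

Lemma cball_inhabited k : exists x : cball A k, True.
Proof. by unshelve eexists (@mkball k 0 _); rewrite ?cnorm0. Qed.

Lemma formula_val_bounded G (p : formula R G) :
  exists M : R, forall r : env G, `|formula_val p r| <= M.
Proof.
elim: p => {G} [G k t1 t2|G n u uc ps IH|G k q [M qM]|G k q [M qM]] /=.
- exists (k%:R + k%:R) => r; rewrite ger0_norm ?cnorm_ge0//.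
  rewrite (le_trans (cnormD _ _))// cnormN lerD//.
    by case: (term_val t1 r).
  by case: (term_val t2 r).
- have [M psM] := choice IH.
  have : compact [set v : 'rV[R]_n | forall i, v ord0 i \in `[- M i, M i]].
    by apply: (@rV_compact _ _ (fun i => `[- M i, M i]%classic)) => i;
       exact: segment_compact.
  move=> /(continuous_compact (continuous_subspaceT uc)).
  move=> /compact_bounded[N [_ /(_ (N + 1))]].
  rewrite ltrDl => /(_ ltr01) uN.
  exists (N + 1) => r; apply: uN; exists (\row_i formula_val (ps i) r) => //.
  by move=> i; rewrite mxE in_itv/= -ler_norml psM.
- exists M => r.
  have [x0 _] := cball_inhabited k.
  have S0 : [set formula_val q (x, r) | x in [set: cball A k]] !=set0.
    by exists (formula_val q (x0, r)), x0.
  have Sub : has_sup [set formula_val q (x, r) | x in [set: cball A k]].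
    split=> //; exists M => _ [x _ <-].
    exact: le_trans (ler_norm _) (qM _).
  rewrite ler_norml; apply/andP; split.
    apply: (@le_trans _ _ (formula_val q (x0, r))).
      by have := qM (x0, r); rewrite ler_norml => /andP[].
    by apply: sup_upper_bound => //; exists x0.
  apply: ge_sup => // _ [x _ <-].
  exact: le_trans (ler_norm _) (qM _).
- exists M => r.
  have [x0 _] := cball_inhabited k.
  have S0 : [set formula_val q (x, r) | x in [set: cball A k]] !=set0.
    by exists (formula_val q (x0, r)), x0.
  have Sub : has_inf [set formula_val q (x, r) | x in [set: cball A k]].
    split=> //; exists (- M) => _ [x _ <-].
    by have := qM (x, r); rewrite ler_norml => /andP[].
  rewrite ler_norml; apply/andP; split.
    apply: lb_le_inf => // _ [x _ <-].
    by have := qM (x, r); rewrite ler_norml => /andP[].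
  apply: (@le_trans _ _ (formula_val q (x0, r))).
    by apply: ge_inf; [case: Sub | exists x0].
  exact: le_trans (ler_norm _) (qM _).
Qed.

End Semantics.

Definition elementarily_equivalent (R : realType) (A B : cstarType R) : Prop :=
  forall p : sentence R, @formula_val R A [::] p tt = @formula_val R B [::] p tt.

Fixpoint map_env (R : realType) (A B : cstarType R)
    (h : forall k, cball A k -> cball B k) (G : seq ball_sort) : env A G -> env B G :=
  if G is k :: G' then fun r => (h k r.1, map_env h r.2) else fun r => r.

(* A map between many-sorted structures is a family of maps, one for each sort; it commutes
   with the function symbols as soon as it preserves the atomic formulas. *)
Definition elementary_embedding (R : realType) (A B : cstarType R)
    (h : forall k, cball A k -> cball B k) : Prop :=
  forall (G : seq ball_sort) (p : formula R G) (r : env A G),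
    formula_val p (map_env h r) = formula_val p r.

(* Main.v *)
(* No uniqueness theorem for the pseudoarc is needed. Continuous functions on P are coded by
   walks: a fine chain covering P gives a coarse map k from P onto {0..N} (nearby points have
   values that differ by at most one), and a tuple of functions is close to v o k for some walk
   v in a power of C. Hereditary indecomposability lets every real function be lifted,
   approximately, through every walk that covers its range: the walk is cut at its largest
   drop, and the three lifts are glued along the parts of P that can be reached by e-chains
   from a low, respectively high, level set; these parts are disjoint for small e, since two
   subcontinua with a common point are nested. Hence, if two tuples follow the same walk up to
   a small error, a fine enough refinement of the walk for the first tuple and one more
   function can also be followed by the second one. By an Ehrenfeucht-Fraisse argument, the
   value of a formula at a tuple is determined, up to a small error, by any walk that the tuple
   follows closely enough. "To follow the walk v" is expressible by a formula, with existential
   quantifiers over bump functions supported on the links of a chain. So C(P) is an atomic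
   model, and a dense sequence of C(P) can be copied into B step by step. *)

Require Import Defs.
From HB Require Import structures.
From mathcomp Require Import all_boot all_order all_algebra.
From mathcomp Require Import all_classical all_reals all_analysis.
From mathcomp Require Import complex lra ring zify.

Set Implicit Arguments.
Unset Strict Implicit.
Unset Printing Implicit Defensive.

Import Order.TTheory GRing.Theory Num.Theory.
Import numFieldNormedType.Exports.
Import ComplexField ComplexField.Normc.

Local Open Scope classical_set_scope.
Local Open Scope complex_scope.
Local Open Scope ring_scope.

(** * Chains in compact metric spaces *)

(** Lifting is the obstacle that forces hereditary indecomposability: on an arc the identity does
    not lift through a walk that turns back by more than the error, since the lift would have to
    pass the later, lower part of the walk after the earlier, higher one. Integer-valued maps
    replace continuous maps to an arc, so that compositions, gluings and reindexings are exact and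
    only the values in the complex plane carry errors. In the logical half, an infimum need not be
    attained, so each property gets two thresholds: a value below 1 yields the weak form, and the
    strong form yields a value at most 0. An implication from [p < 1] to [q <= 0] passes between
    elementarily equivalent algebras, and each existential step falls back from [<= 0] to [< 1]. An
    answer in the game also moves the earlier entries a little; hence the errors [2^-n], and a limit
    for each entry of the copy in [B]. *)

Ltac nat_lia :=
  repeat match goal with
  | H : ?A |- _ =>
    lazymatch A with
    | nat => fail
    | @eq ?T _ _ => tryif unify T nat then fail else clear H
    | ~ (@eq ?T _ _) => tryif unify T nat then fail else clear H
    | is_true (leq _ _) => fail
    | @eq ?T _ _ \/ _ => tryif unify T nat then fail else clear H
    | is_true (leq _ _) \/ _ => fail
    | is_true (leq _ _) /\ _ => fail
    | _ => clear H
    end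
  end; lia.

Record metric_of (R : realType) (T : topologicalType) (d : T -> T -> R) : Prop := {
  dist_eq0 : forall x y, d x y = 0 <-> x = y;
  dist_sym : forall x y, d x y = d y x;
  dist_triangle : forall x y z, d x z <= d x y + d y z;
  nbhs_distP : forall x (A : set T),
    nbhs x A <-> exists2 e : R, 0 < e & [set y | d x y < e] `<=` A
}.

Section CompactMetric.
Context (R : realType) (T : topologicalType) (d : T -> T -> R).
Context (dM : metric_of d) (cT : compact [set: T]).
Implicit Types (x y z : T) (E : set T) (e r : R).

Lemma distxx x : d x x = 0.
Proof. exact/(dist_eq0 dM). Qed.

Lemma dist_ge0 x y : 0 <= d x y.
Proof.
have := dist_triangle dM x y x; rewrite distxx (dist_sym dM y x).
by lra.
Qed.

Lemma ball_nbhs x e : 0 < e -> nbhs x [set y | d x y < e].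
Proof. by move=> e0; apply/(nbhs_distP dM); exists e. Qed.

Lemma dist_openP E : open E <-> forall x, E x -> exists2 e, 0 < e & [set y | d x y < e] `<=` E.
Proof.
rewrite openE; split=> [Eo x /Eo/(nbhs_distP dM)//|h x /h].
by rewrite /interior => ?; apply/(nbhs_distP dM).
Qed.

Lemma dist_ball_open x e : open [set y | d x y < e].
Proof.
apply/dist_openP => y /= xy; exists (e - d x y); first by rewrite subr_gt0.
by move=> z /= yz; have := dist_triangle dM x y z; lra.
Qed.

(** The usual form of compactness below: a cluster point of witnesses for the scales [1 / (n + 1)].
    The conclusion keeps the scale [r] of each witness, so that properties monotone in the scale
    pass to [z]. *)
Lemma cluster_point (Q : R -> T -> Prop) :
  (forall e, 0 < e -> exists x, Q e x) ->
  exists z, forall e, 0 < e -> exists r x, [/\ 0 < r, r < e, Q r x & d z x < e].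
Proof.
move=> Qx.
have Qn n : exists x, Q (n.+1%:R^-1) x by apply: Qx; rewrite invr_gt0.
have [x xQ] := choice Qn.
have [z [_ zx]] := cT (F := x @ \oo) _ (@filterT _ _ _).
exists z => e e0.
have [N _ Ne] : \forall n \near \oo, (n.+1%:R^-1 : R) < e.
  exact: (near_infty_natSinv_lt (PosNum e0)).
have [] := zx [set x n | n in [set n | (N <= n)%N]] [set y | d z y < e].
- by exists N => // n Nn; exists n.
- exact: ball_nbhs.
- move=> _ [[n /= Nn <-] zn]; exists n.+1%:R^-1, (x n); split=> //.
  exact: Ne.
Qed.

Lemma lebesgue_number (Q : T -> T -> Prop) :
  (forall x, exists2 e, 0 < e & forall y z, d x y < e -> d x z < e -> Q y z) ->
  exists2 e, 0 < e & forall y z, d y z < e -> Q y z.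
Proof.
move=> Qe; apply: contrapT => nQ.
have [|x xQ] := @cluster_point (fun e y => exists2 z, d y z < e & ~ Q y z).
  move=> e e0; apply: contrapT => /forallNP nz; apply: nQ; exists e => // y z yz.
  by apply: contrapT => nQyz; apply: (nz y); exists z.
have [e e0 eQ] := Qe x.
have [|r [y [r0 re [z yz nQyz] xy]]] := xQ (e / 2); first lra.
apply: nQyz; apply: eQ; first by lra.
by have := dist_triangle dM x y z; lra.
Qed.

Inductive chain_from (E : set T) (e : R) (x : T) : T -> Prop :=
| chain_refl : E x -> chain_from E e x x
| chain_step y z : chain_from E e x y -> E z -> d y z < e -> chain_from E e x z.

Lemma chain_fromr E e x y : chain_from E e x y -> E y.
Proof. by case. Qed.

Lemma chain_froml E e x y : chain_from E e x y -> E x.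
Proof. by elim. Qed.

Lemma chain_from_trans E e x y z :
  chain_from E e x y -> chain_from E e y z -> chain_from E e x z.
Proof. by move=> xy; elim=> [//|u v _ xu Ev uv]; exact: chain_step xu Ev uv. Qed.

Lemma chain_from_sym E e x y : chain_from E e x y -> chain_from E e y x.
Proof.
elim=> [Ex|u v xu ux Ev uv]; first exact: chain_refl.
apply: chain_from_trans ux; apply: (@chain_step _ _ _ v).
- exact: chain_refl.
- exact: chain_fromr xu.
- by rewrite dist_sym.
Qed.

Lemma chain_from_le E e r x y : e <= r -> chain_from E e x y -> chain_from E r x y.
Proof.
move=> er; elim=> [Ex|u v _ xu Ev uv]; first exact: chain_refl.
exact: chain_step xu Ev (lt_le_trans uv er).
Qed.

(** In a closed set [E] of a compact space this is the connected component of [x] in [E]; the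
    description by chains is the one that survives a limit. *)
Definition chain_component E x := [set y | forall e, 0 < e -> chain_from E e x y].

Lemma chain_component_sub E x : chain_component E x `<=` E.
Proof. by move=> y /(_ 1 ltr01)/chain_fromr. Qed.

Lemma chain_component_closed E x : closed E -> closed (chain_component E x).
Proof.
move=> Ec y cly e e0.
have [z [xz yz]] := cly _ (ball_nbhs y e0).
have Ey : E y.
  by apply: Ec => A /cly[w [xw Aw]]; exists w; split=> //; exact: chain_component_sub xw.
by apply: (chain_step (xz _ e0) Ey); rewrite dist_sym.
Qed.

Lemma chain_component_refl E x : E x -> chain_component E x x.
Proof. by move=> Ex e e0; exact: chain_refl. Qed.

Lemma closed_cluster E (Q : R -> T -> Prop) x : closed E ->
  (forall e, 0 < e -> exists r y, [/\ 0 < r, r < e, Q r y & d x y < e]) ->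
  (forall r y, Q r y -> E y) -> E x.
Proof.
move=> Ec xQ QE; apply: Ec => A /(nbhs_distP dM)[e e0 eA].
have [r [y [_ _ Qy xy]]] := xQ _ e0.
by exists y; split; [exact: QE Qy | exact: eA].
Qed.

Lemma disjoint_closed_dist (A B : set T) : closed A -> closed B -> A `&` B = set0 ->
  exists2 e, 0 < e & forall x y, A x -> B y -> e <= d x y.
Proof.
move=> Ac Bc AB; apply: contrapT => h.
have [|x xQ] := @cluster_point (fun e x => A x /\ exists2 y, B y & d x y < e).
  move=> e e0; apply: contrapT => /forallNP nx; apply: h; exists e => // x y Ax By.
  by rewrite leNgt; apply/negP => xy; apply: (nx x); split=> //; exists y.
have Ax : A x by apply: closed_cluster Ac xQ _ => r y [].
suff Bx : B x by have : (A `&` B) x by []; rewrite AB.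
apply: Bc => C /(nbhs_distP dM)[e e0 eC].
have [|r [y [_ re [Ay [z Bz yz]] xy]]] := xQ (e / 2); first lra.
exists z; split=> //; apply: eC => /=.
by have := dist_triangle dM x y z; lra.
Qed.

Lemma chain_exit E e x y (F : set T) : chain_from E e x y -> F x -> ~ F y ->
  exists u v, [/\ chain_from E e x u, chain_from E e x v, F u, ~ F v & d u v < e].
Proof.
move=> xy Fx; elim: xy => [//|u v xu IH Ev uv nFv].
have [Fu|/IH//] := pselect (F u).
by exists u, v; split=> //; exact: chain_step xu Ev uv.
Qed.

(** If the component split into two closed parts at distance at least [e], ever finer chains from
    [x] to the other part would leave the [e / 3]-neighbourhood of the part of [x]. Their exit
    points cluster at a point of the component that can lie in neither part. *)
Lemma chain_component_connected E x : closed E -> E x -> connected (chain_component E x).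
Proof.
move=> Ec Ex; set K := chain_component E x.
have Kc : closed K := chain_component_closed Ec.
apply/connectedP => F [F0 KF [sF1 sF2]].
have sep1 : closure (F false) `<=` F false.
  move=> y cly; have : K y by apply: Kc; apply: closure_subset cly; rewrite KF; left.
  rewrite KF => -[//|Fy]; have : (closure (F false) `&` F true) y by [].
  by rewrite sF1.
have sep2 : closure (F true) `<=` F true.
  move=> y cly; have : K y by apply: Kc; apply: closure_subset cly; rewrite KF; right.
  rewrite KF => -[Fy|//]; have : (F false `&` closure (F true)) y by [].
  by rewrite sF2.
have F12 : F false `&` F true = set0.
  by apply/seteqP; split=> // y [y1 y2]; rewrite -sF1; split=> //; exact: subset_closure.
suff key b : F b x -> F (~~ b) = set0.
  have : K x by exact: chain_component_refl.
  rewrite KF => -[/key/=|/key/=] F'0.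
    by have [y] := F0 true; rewrite F'0.
  by have [y] := F0 false; rewrite F'0.
move=> Fbx.
have Fc c : closed (F c) by case: c.
have FI : F b `&` F (~~ b) = set0 by case: (b) => //; rewrite setIC.
apply/seteqP; split=> // y Fy.
have Ky : K y by rewrite KF; case: (b) Fy; [left|right].
have [e e0 eF] := disjoint_closed_dist (Fc b) (Fc (~~ b)) FI.
pose N := [set z | exists2 w, F b w & d w z < e / 3].
have [|z zQ] := @cluster_point (fun r v => exists u,
    [/\ chain_from E r x v, N u, ~ N v & d u v < r]).
  move=> r r0; have [] := @chain_exit E r x y N (Ky _ r0).
  - by exists x => //; rewrite distxx; lra.
  - by move=> [w Fw wy]; have := eF w y Fw Fy; lra.
  - by move=> u [v [xu xv Nu nNv uv]]; exists v, u.
have Ez : E z by apply: closed_cluster Ec zQ _ => r v [u [/chain_fromr]].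
have Kz : K z.
  move=> r r0; have [s [v [s0 sr [u [xv _ _ _]] zv]]] := zQ _ r0.
  apply: (@chain_step _ _ _ v) => //; last by rewrite dist_sym.
  exact: chain_from_le (ltW sr) xv.
have : F b z \/ F (~~ b) z by move: Kz; rewrite KF; case: (b) => -[]; tauto.
have [|r [v [r0 re [u [_ [w Fw wu] nNv uv]] zv]]] := zQ (e / 6); first lra.
case=> Fz.
  by apply: nNv; exists z => //; lra.
have := eF w z Fw Fz.
have := dist_triangle dM w u z; have := dist_triangle dM u v z.
rewrite (dist_sym dM v z); lra.
Qed.

Lemma chain_component_subcontinuum E x :
  closed E -> E x -> subcontinuum (chain_component E x).
Proof.
move=> Ec Ex; split.
- by exists x; exact: chain_component_refl.
- by apply: subclosed_compact cT _ => //; exact: chain_component_closed.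
- exact: chain_component_connected.
Qed.

Definition reachable (A E : set T) (e : R) := [set y | exists2 x, A x & chain_from E e x y].

Lemma reachable_component (A E : set T) x : closed A -> closed E -> E x ->
  (forall e, 0 < e -> reachable A E e x) -> A `&` chain_component E x !=set0.
Proof.
move=> Ac Ec Ex xA.
have [|a aQ] := @cluster_point (fun e a => A a /\ chain_from E e a x).
  by move=> e /xA[a Aa ax]; exists a.
have Ea : E a by apply: closed_cluster Ec aQ _ => r v [_ /chain_froml].
exists a; split; first by apply: closed_cluster Ac aQ _ => r v [].
move=> e e0; have [r [v [r0 re [Av vx] av]]] := aQ _ e0.
apply: (@chain_step _ _ _ v) => //; last by rewrite dist_sym.
apply: chain_from_sym; exact: chain_from_le (ltW re) vx.
Qed.

(** If the two sets met for every [e], a cluster point [z] of common points would have a component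
    in [E] meeting [A] and a component in [F] meeting [B]. Their union is a continuum, so one of
    them contains the other, and then [B] meets [E] or [A] meets [F]. *)
Lemma reachable_disjoint (A B E F : set T) : hereditarily_indecomposable T ->
  closed A -> closed B -> closed E -> closed F ->
  A `&` F = set0 -> B `&` E = set0 ->
  exists2 e, 0 < e & reachable A E e `&` reachable B F e = set0.
Proof.
move=> hi Ac Bc Ec Fc AF BE; apply: contrapT => h.
have [|z zQ] := @cluster_point (fun e z => reachable A E e z /\ reachable B F e z).
  move=> e e0; apply: contrapT => nz; apply: h; exists e => //.
  by apply/seteqP; split=> // z [zA zB]; apply: nz; exists z.
have Ez : E z by apply: closed_cluster Ec zQ _ => r v [[a _ /chain_fromr]].
have Fz : F z by apply: closed_cluster Fc zQ _ => r v [_ [a _ /chain_fromr]].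
have lift (C G : set T) : G z ->
   (forall e, 0 < e -> exists r y, [/\ 0 < r, r < e, reachable C G r y & d z y < e]) ->
   forall e, 0 < e -> reachable C G e z.
  move=> Gz zC e e0; have [r [y [r0 re [c Cc cy] zy]]] := zC _ e0.
  exists c => //; apply: (@chain_step _ _ _ y) => //; last by rewrite dist_sym.
  exact: chain_from_le (ltW re) cy.
have [|a [Aa za]] := reachable_component Ac Ec Ez.
  by apply: lift => // e /zQ[r [y [? ? [] *]]]; exists r, y.
have [|b [Bb zb]] := reachable_component Bc Fc Fz.
  by apply: lift => // e /zQ[r [y [? ? [] *]]]; exists r, y.
have KE := chain_component_subcontinuum Ec Ez.
have KF := chain_component_subcontinuum Fc Fz.
set K := chain_component E z in KE za; set L := chain_component F z in KF zb.
have KL : subcontinuum (K `|` L).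
  case: KE KF => K0 cK coK [L0 cL coL]; split.
  - by exists z; left; exact: chain_component_refl.
  - exact: compactU.
  - by apply: connectedU => //; exists z; split; exact: chain_component_refl.
have [KE'|LE'] := hi _ _ _ KL KE KF erefl.
  have : (B `&` E) b by split=> //; apply: chain_component_sub (z) _ _; rewrite -/K KE'; right.
  by rewrite BE.
have : (A `&` F) a by split=> //; apply: chain_component_sub (z) _ _; rewrite -/L LE'; left.
by rewrite AF.
Qed.

End CompactMetric.

(** * Coarse maps and lifting through walks *)

Section Coarse.
Context (R : realType) (T : topologicalType) (d : T -> T -> R).
Context (dM : metric_of d) (cT : compact [set: T]).

(* An integer-valued substitute for continuity. *)
Definition coarse (k : T -> nat) :=
  exists2 e : R, 0 < e & forall x y, d x y < e -> (k x <= (k y).+1)%N.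

Definition onto_upto (N : nat) (k : T -> nat) :=
  (forall x, (k x <= N)%N) /\ forall j, (j <= N)%N -> exists x, k x = j.

Definition unif_cont (g : T -> R) :=
  forall e, 0 < e -> exists2 r : R, 0 < r & forall x y, d x y < r -> `|g x - g y| < e.

(** A skipped value [j] would make the set where [k < j] clopen. *)
Lemma coarse_interval k : connected [set: T] -> coarse k ->
  forall x y j, (k x <= j)%N -> (j <= k y)%N -> exists z, k z = j.
Proof.
move=> coT [e e0 kc] x y j xj jy; apply: contrapT => /forallNP nj.
have opn (Q : pred nat) : (forall a b, (a <= b.+1)%N -> (b <= a.+1)%N ->
    Q a -> a != j -> b != j -> Q b) -> open [set z | Q (k z)].
  move=> hQ; apply/(dist_openP dM) => z /= Qz; exists e => // w /= zw.
  apply: hQ Qz _ _; [exact: kc | apply: kc; rewrite (dist_sym dM)// | exact/eqP/nj..].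
have o1 : open [set z | (k z < j)%N] by apply: (opn (fun a => (a < j)%N)) => a b; nat_lia.
have o2 : open [set z | (j < k z)%N] by apply: (opn (fun a => (j < a)%N)) => a b; nat_lia.
suff E : [set z | (k z < j)%N] = [set: T].
  by have := nj y; have : [set: T] y by []; rewrite -E /=; nat_lia.
apply: coT.
- by exists x => /=; have := nj x; nat_lia.
- by exists [set z | (k z < j)%N] => //; rewrite setTI.
- exists (~` [set z | (j < k z)%N]); first exact: open_closedC.
  rewrite setTI; apply/seteqP; split=> z /=; first nat_lia.
  by have := nj z; nat_lia.
Qed.

Lemma coarse_onto k N x y : connected [set: T] -> coarse k ->
  (forall z, (k z <= N)%N) -> k x = 0%N -> k y = N -> onto_upto N k.
Proof.
move=> coT kc kN kx ky; split=> // j jN.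
by apply: (coarse_interval coT kc (x := x) (y := y)); nat_lia.
Qed.

Lemma coarse_comp k N (w : nat -> nat) : coarse k -> (forall x, (k x <= N)%N) ->
  (forall i, (i < N)%N -> (w i <= (w i.+1).+1)%N /\ (w i.+1 <= (w i).+1)%N) ->
  coarse (w \o k).
Proof.
move=> [e e0 kc] kN ww; exists e => // x y xy /=.
have := kc x y xy; have := kc y x; rewrite (dist_sym dM) => /(_ xy).
have := kN x; have := kN y; move: (k x) (k y) => a b bN aN ba ab.
have [->|/eqP aNb] := eqVneq a b; first nat_lia.
have [aE|bE] : a = b.+1 \/ b = a.+1 by nat_lia.
  by subst a; have := ww b; nat_lia.
by subst b; have := ww a; nat_lia.
Qed.

Lemma unif_cont_closed g c : unif_cont g -> closed [set x | g x <= c].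
Proof.
move=> guc x clx /=; rewrite leNgt; apply/negP => cx.
have [|r r0 gr] := guc (g x - c); first lra.
have [y [/= gy xy]] := clx _ (ball_nbhs dM x r0).
by have := gr _ _ xy; rewrite ltr_norml; lra.
Qed.

Lemma unif_contN g : unif_cont g -> unif_cont (fun x => - g x).
Proof.
move=> guc e /guc[r r0 gr]; exists r => // x y /gr.
by rewrite -opprD normrN.
Qed.

Lemma unif_cont_closed_ge g c : unif_cont g -> closed [set x | c <= g x].
Proof.
move=> /unif_contN guc; suff <- : [set x | - g x <= - c] = [set x | c <= g x].
  exact: unif_cont_closed.
by apply/seteqP; split=> x /=; rewrite lerN2.
Qed.

End Coarse.

Section Lift.
Context (R : realType) (T : topologicalType) (d : T -> T -> R).
Context (dM : metric_of d) (cT : compact [set: T]) (hi : hereditarily_indecomposable T).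
Context (g : T -> R) (guc : unif_cont d g).

(** The function [g] may leave [[p, q]]; there the lift stays at an end of the walk. The margin
    [eta], on which the lift is already constant, is what allows lifts to be glued. Of the error
    [2 * eps], one half pays for a step of [u] and one for the perturbation in the monotone case. *)
Definition lifts (m : nat) (u : nat -> R) (eps p q : R) :=
  exists (k : T -> nat) (eta : R),
  [/\ 0 < eta, forall x, (k x <= m)%N, coarse d k,
      forall x, p <= g x -> g x <= q -> `|u (k x) - g x| <= 2 * eps
    & forall x, (g x <= p + eta -> k x = 0%N) /\ (q - eta <= g x -> k x = m)].

Definition walk (m : nat) (u : nat -> R) (eps p q : R) :=
  [/\ u 0%N = p, u m = q, forall i, (i <= m)%N -> p <= u i /\ u i <= q
    & forall i, (i < m)%N -> `|u i.+1 - u i| <= eps].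

Lemma threshold (tau : nat -> R) (m : nat) (t : R) : exists k,
  [/\ (k <= m)%N, k = 0%N \/ tau k <= t & k = m \/ t < tau k.+1].
Proof.
elim: m => [|m [k [km k0 kt]]]; first by exists 0%N; split; auto.
case: kt => [km'|kt]; last by exists k; split; [nat_lia | | right].
subst k; have [tm|mt] := leP (tau m.+1) t; first by exists m.+1; split; auto.
by exists m; split; [nat_lia | | right].
Qed.

Lemma lift_monotone m u (eps p q : R) : 0 < eps -> p < q -> walk m u eps p q ->
  (forall i, (i < m)%N -> u i <= u i.+1) -> lifts m u eps p q.
Proof.
move=> eps0 pq [u0 um ub us] mono.
have qp0 : 0 < q - p by lra.
pose kap := Num.min 1 (eps / (q - p)).
have kap0 : 0 < kap by rewrite lt_min ltr01/= divr_gt0.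
have kap1 : kap <= 1 by rewrite ge_min lexx.
have kapq : kap * (q - p) <= eps.
  by rewrite -ler_pdivlMr// ge_min lexx orbT.
(* Division by [m + 1] instead of [m] gives [tau m = q - gam]. This gap below [q], and the gap of at
   least [gam] between [p] and the next threshold, provide the margin of the lift. *)
pose g0 := (q - p) / m.+1%:R.
have g0m : g0 * m.+1%:R = q - p by rewrite divfK// pnatr_eq0.
have g00 : 0 < g0 by rewrite divr_gt0.
pose gam := kap * g0.
have gam0 : 0 < gam by rewrite mulr_gt0.
(* a strictly increasing perturbation of [u], whose values stay inside ]p, q[ *)
pose tau i := (1 - kap) * u i + kap * (p + g0 * i%:R).
have tauS i : (i < m)%N -> tau i + gam <= tau i.+1.
  move=> /mono ui; rewrite /tau /gam -natr1.
  have : 0 <= (1 - kap) * (u i.+1 - u i) by rewrite mulr_ge0//; lra.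
  by nra.
have tauL i j : (i < j)%N -> (j <= m)%N -> tau i + gam <= tau j.
  elim: j => // j IH; rewrite ltnS leq_eqVlt => /orP[/eqP->|ij] jm; first exact: tauS.
  by have := IH ij (ltnW jm); have := tauS j jm; lra.
have tau_u i : (i <= m)%N -> u i - eps <= tau i /\ tau i <= u i + eps.
  move=> im; have [pu uq] := ub i im.
  have gi : 0 <= g0 * i%:R by rewrite mulr_ge0 ?ler0n// ltW.
  have gi' : g0 * i%:R <= q - p by rewrite -g0m ler_pM2l// ler_nat; nat_lia.
  have -> : tau i = u i + kap * (p + g0 * i%:R - u i) by rewrite /tau; ring.
  have : kap * (p + g0 * i%:R - u i) <= kap * (q - p) by rewrite ler_pM2l//; lra.
  have : kap * (p - q) <= kap * (p + g0 * i%:R - u i) by rewrite ler_pM2l//; lra.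
  have -> : kap * (p - q) = - (kap * (q - p)) by ring.
  by lra.
have tau0 : tau 0%N = p by rewrite /tau u0; ring.
have taum : tau m = q - gam.
  have qE : q = p + g0 * (m%:R + 1) by rewrite natr1 g0m addrC subrK.
  by rewrite /tau um /gam; rewrite {1 2}qE; ring.
have [k kP] := choice (fun x => threshold tau m (g x)).
(* Thresholds are at least [gam] apart, so a change of [g] by less than [gam] moves the index by at
   most one. *)
have [r r0 gr] := guc gam0.
exists k, (gam / 2); split.
- lra.
- by move=> x; case: (kP x).
- exists r => // x y xy; rewrite leqNgt; apply/negP => kxy.
  have [kxm [kx0|kx1] _] := kP x; first nat_lia.
  have [kym _ [ky0|ky1]] := kP y; first nat_lia.
  have := tauL (k y).+1 (k x) kxy kxm; have := gr _ _ xy.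
  by rewrite ltr_norml; lra.
- move=> x pg gq; have [km k0 k1] := kP x.
  rewrite ler_norml.
  have up : g x <= u (k x) + 2 * eps.
    case: k1 => [->|k1]; first by rewrite um; lra.
    have [km'|mk] := ltnP (k x) m; last first.
      have -> : k x = m by nat_lia.
      by rewrite um; lra.
    have := us _ km'; have := tau_u (k x).+1 km'; rewrite ler_norml; lra.
  have dn : u (k x) - 2 * eps <= g x.
    case: k0 => [->|k0]; first by rewrite u0; lra.
    have := tau_u _ km; lra.
  by lra.
- move=> x; have [km k0 k1] := kP x; split=> gx.
    apply/eqP; rewrite -leqn0 leqNgt; apply/negP => kx.
    case: k0 => [|k0]; first nat_lia.
    by have := tauL _ _ kx km; lra.
  case: k1 => [//|k1]; apply/eqP; rewrite eqn_leq km/= leqNgt; apply/negP => kx.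
  suff : tau (k x).+1 <= tau m by lra.
  have [->//|/eqP kxm] := eqVneq (k x).+1 m.
  have kxm' : ((k x).+1 < m)%N by nat_lia.
  by have := tauL _ _ kxm' (leqnn _); lra.
Qed.

(* The three pieces of the walk are used on the points reachable from a neighbourhood of
   [g <= u t], on the rest, and on the points reachable from a neighbourhood of [u s <= g].
   Where two of these parts meet, [g] is close to [u s] or to [u t], and there the partial
   lifts are constant, equal to [s] or [t]. *)
Lemma lift_glue m s t u (eps p q : R) : walk m u eps p q -> (s < t)%N -> (t <= m)%N ->
  u t < u s ->
  lifts s u eps p (u s) ->
  lifts (t - s) (fun i => u (t - i)%N) eps (u t) (u s) ->
  lifts (m - t) (fun i => u (t + i)%N) eps (u t) q -> lifts m u eps p q.
Proof.
move=> [u0 um ub us] st tm ut [k1 [h1 [h10 k1m [e1 e10 k1c] k1u k1e]]].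
move=> [k2 [h2 [h20 k2m [e2 e20 k2c] k2u k2e]]].
move=> [k3 [h3 [h30 k3m [e3 e30 k3c] k3u k3e]]].
set b := u s in ut k1u k1e k2u k2e k3u k3e *; set a := u t in ut k1u k1e k2u k2e k3u k3e *.
have [pa aq] : p <= a /\ a <= q by apply: ub.
have [pb bq] : p <= b /\ b <= q by apply: ub; nat_lia.
(* A short step out of [X0] ends above [b - 2 * h] and therefore starts above [b - 3 * h]; since
   [3 * h] is at most [h1] and [h2], both lifts [k1] and [k2] are constant there. The same holds for
   [X2] below [a + 3 * h], with [k2] and [k3]. The bound [8 * h <= b - a] keeps these two zones
   apart. *)
have [h [h0 hh1 hh2 hh3 hab]] : exists h : R,
    [/\ 0 < h, 3 * h <= h1, 3 * h <= h2, 3 * h <= h3 & 8 * h <= b - a].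
  exists (Num.min (Num.min (h1 / 3) (h2 / 3)) (Num.min (h3 / 3) ((b - a) / 8))).
  set x : R := Num.min _ _; have : x <= h1 / 3 by rewrite !ge_min lexx.
  have : x <= h2 / 3 by rewrite !ge_min lexx ?orbT.
  have : x <= h3 / 3 by rewrite !ge_min lexx ?orbT.
  have : x <= (b - a) / 8 by rewrite !ge_min lexx ?orbT.
  have : 0 < x by rewrite !lt_min; repeat (apply/andP; split); lra.
  move=> *; split; lra.
pose A := [set x | g x <= a + h]; pose E := [set x | g x <= b - 2 * h].
pose B := [set x | b - h <= g x]; pose F := [set x | a + 2 * h <= g x].
have [||r r0 rAB] := @reachable_disjoint _ _ d dM cT A B E F hi
  (unif_cont_closed dM guc) (unif_cont_closed_ge dM guc)
  (unif_cont_closed dM guc) (unif_cont_closed_ge dM guc).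
- by apply/seteqP; split=> // x []; rewrite /A /F /= => ? ?; exfalso; lra.
- by apply/seteqP; split=> // x []; rewrite /B /E /= => ? ?; exfalso; lra.
pose X0 := reachable d A E r; pose X2 := reachable d B F r.
have X02 x : X0 x -> X2 x -> False.
  by move=> x0 x2; have : (X0 `&` X2) x by []; rewrite rAB.
have X0E x : X0 x -> g x <= b - 2 * h by case=> ? _ /chain_fromr.
have X2F x : X2 x -> a + 2 * h <= g x by case=> ? _ /chain_fromr.
have AX0 x : g x <= a + h -> X0 x.
  by move=> gx; exists x => //; apply: chain_refl; rewrite /E /=; lra.
have BX2 x : b - h <= g x -> X2 x.
  by move=> gx; exists x => //; apply: chain_refl; rewrite /F /=; lra.
have X0S x y : X0 x -> d x y < r -> g y <= b - 2 * h -> X0 y.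
  by move=> [z Az zx] xy gy; exists z => //; exact: chain_step zx gy xy.
have X2S x y : X2 x -> d x y < r -> a + 2 * h <= g y -> X2 y.
  by move=> [z Bz zx] xy gy; exists z => //; exact: chain_step zx gy xy.
have [r' r'0 gr'] := guc h0.
(* The middle piece falls from [b] at [s] to [a] at [t]. It was reversed to become a walk from [a]
   to [b], so its index is counted down from [t]. *)
pose k x := if `[< X0 x >] then k1 x else if `[< X2 x >] then (t + k3 x)%N else (t - k2 x)%N.
exists k, h; split=> //.
- move=> x; rewrite /k; case: asboolP => _; first by have := k1m x; nat_lia.
  case: asboolP => _; last nat_lia.
  by have := k3m x; nat_lia.
- pose e := Num.min (Num.min (Num.min e1 e2) e3) (Num.min r r').
  exists e; first by rewrite !lt_min e10 e20 e30 r0 r'0.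
  move=> x y; rewrite !lt_min => /andP[/andP[/andP[xy1 xy2] xy3] /andP[xyr xyr']].
  have yx1 : d y x < e1 by rewrite (dist_sym dM).
  have yx2 : d y x < e2 by rewrite (dist_sym dM).
  have yxr : d y x < r by rewrite (dist_sym dM).
  have := gr' _ _ xyr'; rewrite ltr_norml => /andP[gxy1 gxy2].
  have := k1m x; have := k1m y; have := k2m x; have := k2m y.
  rewrite /k; case: (asboolP (X0 x)) => x0; case: (asboolP (X0 y)) => y0.
  + by have := k1c x y xy1; nat_lia.
  + have gy : b - 2 * h < g y by rewrite ltNge; apply/negP => gy; exact/y0/(X0S x).
    have -> : k1 x = s by apply: (k1e x).2; lra.
    case: (asboolP (X2 y)) => y2.
      have gx : g x < a + 2 * h.
        rewrite ltNge; apply/negP => gx; apply: (X02 x) => //; exact: X2S y2 _ gx.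
      exfalso; lra.
    have -> : k2 y = (t - s)%N by apply: (k2e y).2; lra.
    by nat_lia.
  + have gx : b - 2 * h < g x by rewrite ltNge; apply/negP => gx; exact/x0/(X0S y).
    have -> : k1 y = s by apply: (k1e y).2; lra.
    case: (asboolP (X2 x)) => x2.
      have gy : g y < a + 2 * h.
        rewrite ltNge; apply/negP => gy; apply: (X02 y) => //; exact: X2S x2 _ gy.
      exfalso; lra.
    have -> : k2 x = (t - s)%N by apply: (k2e x).2; lra.
    by nat_lia.
  + case: (asboolP (X2 x)) => x2; case: (asboolP (X2 y)) => y2.
    * by have := k3c x y xy3; nat_lia.
    * have gy : g y < a + 2 * h by rewrite ltNge; apply/negP => gy; exact/y2/(X2S x).
      have -> : k3 x = 0%N by apply: (k3e x).1; lra.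
      have -> : k2 y = 0%N by apply: (k2e y).1; lra.
      by nat_lia.
    * have gx : g x < a + 2 * h by rewrite ltNge; apply/negP => gx; exact/x2/(X2S y).
      have -> : k2 x = 0%N by apply: (k2e x).1; lra.
      by nat_lia.
    * by have := k2c y x yx2; nat_lia.
- move=> x pg gq; rewrite /k; case: asboolP => x0.
    by apply: k1u => //; have := X0E x x0; lra.
  case: asboolP => x2; first by apply: k3u => //; have := X2F x x2; lra.
  apply: k2u.
    by rewrite leNgt; apply/negP => gx; apply: x0; apply: AX0; lra.
  by rewrite leNgt; apply/negP => gx; apply: x2; apply: BX2; lra.
- move=> x; rewrite /k; split=> gx.
    have x0 : X0 x by apply: AX0; lra.
    by rewrite asboolT//; apply: (k1e x).1; lra.
  have x2 : X2 x by apply: BX2; lra.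
  rewrite asboolF; last by move=> x0; exact: X02 x0 x2.
  rewrite asboolT// (k3e x).2; [nat_lia | lra].
Qed.

Lemma lift_walk m u (eps p q : R) : 0 < eps -> p < q -> walk m u eps p q -> lifts m u eps p q.
Proof.
move=> eps0; elim/ltn_ind: m u p q => m IH u p q pq uw.
have [mono|nmono] := pselect (forall i, (i < m)%N -> u i <= u i.+1).
  exact: lift_monotone.
have [i im ui] : exists2 i, (i < m)%N & u i.+1 < u i.
  apply: contrapT => h; apply: nmono => i im; rewrite leNgt; apply/negP => ui.
  by apply: h; exists i.
(* Cut at the largest drop [u s - u t], [s <= t]: each of the three pieces then has its
   extreme values at its ends, so that the induction hypothesis applies to it. *)
pose F (z : 'I_m.+1 * 'I_m.+1) := u z.1 - u z.2.
pose z0 : 'I_m.+1 * 'I_m.+1 := (inord i, inord i.+1).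
have z0P : (z0.1 <= z0.2)%N by rewrite /= !inordK; nat_lia.
case: (arg_maxP F (P := fun z : 'I_m.+1 * 'I_m.+1 => (z.1 <= z.2)%N) z0P) => -[s t] /= st Fmax.
have {Fmax}drop a b : (a <= b)%N -> (b <= m)%N -> u a - u b <= u s - u t.
  move=> ab bm; have := Fmax (inord a, inord b).
  by rewrite /F/= !inordK ?ltnS//; [exact | exact: leq_trans bm].
have uts : u t < u s by have := drop i i.+1 (leqnSn i) im; lra.
have {}st : (s < t)%N.
  rewrite ltn_neqAle st andbT; apply/eqP => /val_inj ste.
  by move: uts; rewrite ste ltxx.
have tm : (t <= m)%N by rewrite -ltnS.
case: (uw) => u0 um ub us.
have [pt tq] := ub _ tm.
have [ps sq] : p <= u s /\ u s <= q by apply: ub; nat_lia.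
apply: (lift_glue uw st tm uts); apply: IH.
- nat_lia.
- lra.
- split=> // j js; last by apply: us; nat_lia.
  have [] := ub j; first nat_lia.
  have jt : (j <= t)%N by nat_lia.
  by have := drop j t jt tm; lra.
(* The middle piece is strictly shorter than the walk: [s = 0] and [t = m] would make the drop equal
   to [p - q], which is negative. *)
- have [s0|/eqP s0] := eqVneq (s : nat) 0%N; last nat_lia.
  have [tm'|/eqP tm'] := eqVneq (t : nat) m; last nat_lia.
  by exfalso; move: uts; rewrite s0 tm' u0 um; lra.
- lra.
- split; rewrite ?subn0//.
  + by congr u; nat_lia.
  + move=> j jst; have sj : (s <= t - j)%N by nat_lia.
    have jm : (t - j <= m)%N by nat_lia.
    by have := drop (t - j)%N t (leq_subr _ _) tm; have := drop s (t - j)%N sj jm; lra.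
  + move=> j jst; rewrite distrC (_ : t - j = (t - j.+1).+1)%N; last nat_lia.
    by apply: us; nat_lia.
- nat_lia.
- lra.
- split; rewrite ?addn0//.
  + by rewrite -um; congr u; nat_lia.
  + move=> j jst; have sj : (s <= t + j)%N by nat_lia.
    have jm : (t + j <= m)%N by nat_lia.
    by have := drop s (t + j)%N sj jm; have [? ?] := ub (t + j)%N jm; lra.
  + by move=> j jst; rewrite addnS; apply: us; nat_lia.
Qed.

End Lift.

(** * Fine chains *)

Section Smoothing.
Context (R : realType) (T : topologicalType) (d : T -> T -> R).
Context (dM : metric_of d).

(** The Lipschitz envelope: [g x] is the infimum of [psi y + L * d x y]. The slope satisfies
    [2 * S <= L * e], so points [y] at distance at least [e] never undercut [psi x]; closer ones do
    so by at most [zeta]. *)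
Lemma smoothing (psi : T -> R) (S zeta e : R) : 0 <= zeta -> 0 < e ->
  (forall x, `|psi x| <= S) -> (forall x y, d x y < e -> `|psi x - psi y| <= zeta) ->
  exists2 g : T -> R, unif_cont d g & forall x, psi x - zeta <= g x /\ g x <= psi x.
Proof.
move=> z0 e0 psiS psiz.
have [[x0 _]|T0] := pselect (exists x : T, True); last first.
  exists psi => [r r0|x]; last by case: T0; exists x.
  by exists 1 => // x; case: T0; exists x.
have S0 : 0 <= S by apply: le_trans (psiS x0).
pose L := 2 * S / e + 1.
have L0 : 0 < L by rewrite ltr_wpDl// divr_ge0 ?mulr_ge0// ltW.
have Le : 2 * S <= L * e by rewrite /L [leRHS]mulrDl divfK ?gt_eqF//; lra.
pose V x := [set psi y + L * d x y | y in [set: T]].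
have Vb x y : - S <= psi y + L * d x y.
  have : 0 <= L * d x y by rewrite mulr_ge0 ?(dist_ge0 dM)// ltW.
  by have := psiS y; rewrite ler_norml; lra.
have Vi x : has_lbound (V x) by exists (- S) => _ [y _ <-].
have V0 x : V x !=set0 by exists (psi x0 + L * d x x0), x0.
pose g x := inf (V x).
have gle x y : g x <= psi y + L * d x y by apply: ge_inf => //; exists y.
have gL x y : g x - g y <= L * d x y.
  rewrite lerBlDr -lerBlDl; apply: lb_le_inf => // _ [z _ <-].
  have := gle x z; have := dist_triangle dM x y z.
  rewrite -(ler_pM2l L0) mulrDr; lra.
exists g => [r r0|x].
  exists (r / L) => [|x y]; first by rewrite divr_gt0.
  rewrite ltr_pdivlMr// mulrC => xy.
  have := gL x y; have := gL y x; rewrite (dist_sym dM y x) ltr_norml; lra.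
split; last by have := gle x x; rewrite (distxx dM) mulr0 addr0.
apply: lb_le_inf => // _ [y _ <-].
have [xy|xy] := ltP (d x y) e.
  have := psiz _ _ xy; have : 0 <= L * d x y by rewrite mulr_ge0 ?(dist_ge0 dM)// ltW.
  by rewrite ler_norml; lra.
have : L * e <= L * d x y by rewrite ler_pM2l.
by have := psiS x; have := psiS y; rewrite !ler_norml; lra.
Qed.

End Smoothing.

(** Go down from [i] to 0, up to [M], then down to [j]. Visiting every index makes the reindexing
    maps obtained by lifting surjective. *)
Lemma covering_walk (M i j : nat) : (i <= M)%N -> (j <= M)%N ->
  exists (m : nat) (w : nat -> nat),
  [/\ w 0%N = i, w m = j, forall t, (t <= m)%N -> (w t <= M)%N,
      forall t, (t < m)%N -> (w t <= (w t.+1).+1)%N /\ (w t.+1 <= (w t).+1)%N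
    & forall l, (l <= M)%N -> exists2 t, (t <= m)%N & w t = l].
Proof.
move=> iM jM; exists (i + M + (M - j))%N.
exists (fun t => if (t <= i)%N then (i - t)%N else
  if (t <= i + M)%N then (t - i)%N else (M - (t - i - M))%N); split.
- by rewrite leq0n subn0.
- by case: ifP => ?; [|case: ifP => ?]; lia.
- by move=> t tm; case: ifP => ?; [|case: ifP => ?]; lia.
- by move=> t tm; repeat (case: ifP => ?); lia.
- move=> l lM; exists (i + l)%N; first lia.
  by case: ifP => ?; [|case: ifP => ?]; lia.
Qed.

Section Chains.
Context (R : realType) (P : continuumType) (d : P -> P -> R).
Context (dM : metric_of d).

Let cT : compact [set: P] := continuum_compact.
Let coT : connected [set: P] := continuum_connected.

Definition mesh (k : P -> nat) (e : R) :=
  forall x y, (k x <= (k y).+1)%N -> (k y <= (k x).+1)%N -> d x y < e.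

Lemma finite_ball_cover (e : R) : 0 < e -> exists (m : nat) (c : 'I_m -> P),
  \bigcup_i [set y | d (c i) y < e] = [set: P].
Proof.
move=> e0; have := cT; rewrite compact_cover.
move=> /(_ P [set: P] (fun x => [set y | d x y < e])) [].
- move=> x _. exact: (dist_ball_open dM).
- by move=> x _; exists x => //=; rewrite (distxx dM).
move=> D _ cov; exists (size (finmap.enum_fset D)), (fun i => nth point (finmap.enum_fset D) i).
apply/seteqP; split=> // y _.
have [x /= xD xy] := cov y I.
have iD : (index x (finmap.enum_fset D) < size (finmap.enum_fset D))%N by rewrite index_mem.
by exists (Ordinal iD) => //=; rewrite nth_index.
Qed.

Lemma open_cover_lebesgue (n : nat) (U : 'I_n -> set P) : (forall i, open (U i)) ->
  \bigcup_i U i = [set: P] ->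
  exists2 e : R, 0 < e & forall x, exists i, [set y | d x y < e] `<=` U i.
Proof.
move=> Uo Uc; apply: contrapT => h.
have [|x xQ] := @cluster_point R P d dM cT
    (fun e x => forall i, ~ [set y | d x y < e] `<=` U i).
  move=> e e0; apply: contrapT => /forallNP nx; apply: h; exists e => // x.
  by apply: contrapT => /forallNP; exact: nx.
have [i _ Uix] : (\bigcup_i U i) x by rewrite Uc.
have [e e0 eU] := (dist_openP dM (U i)).1 (Uo i) x Uix.
have [|r [y [r0 re yU xy]]] := xQ (e / 2); first lra.
apply: (yU i) => z /= yz; apply: eU => /=.
by have := dist_triangle dM x y z; lra.
Qed.

Lemma coarse_normalize (k : P -> nat) n e : coarse d k -> (forall x, (k x <= n)%N) ->
  mesh k e -> exists (M : nat) (k' : P -> nat),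
    [/\ coarse d k', onto_upto M k' & mesh k' e].
Proof.
move=> kc kn km.
have ex : exists j, `[< exists x, k x = j >] by exists (k point); apply/asboolP; exists point.
have bd j : `[< exists x, k x = j >] -> (j <= n)%N by move=> /asboolP[x <-].
pose lo := ex_minn ex; pose hi := ex_maxn ex bd.
have [[x0 x0E] loP] : (exists x, k x = lo) /\ forall x, (lo <= k x)%N.
  rewrite /lo; case: ex_minnP => m /asboolP mx ml; split=> // x.
  by apply: ml; apply/asboolP; exists x.
have [[x1 x1E] hiP] : (exists x, k x = hi) /\ forall x, (k x <= hi)%N.
  rewrite /hi; case: ex_maxnP => m /asboolP mx ml; split=> // x.
  by apply: ml; apply/asboolP; exists x.
have k'c : coarse d (fun x => k x - lo)%N.
  by have [r r0 rk] := kc; exists r => // x y /rk; have := loP y; have := loP x; nat_lia.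
exists (hi - lo)%N, (fun x => k x - lo)%N; split=> //.
  apply: (coarse_onto dM (x := x0) (y := x1) coT k'c); rewrite ?x0E ?x1E ?subnn//.
  by move=> x; have := hiP x; nat_lia.
by move=> x y; have := loP x; have := loP y => ? ? ? ?; apply: km; nat_lia.
Qed.

(** Let [k x] be a link that contains a ball of Lebesgue radius about [x]. Close points then have
    links that meet, which bounds the jump of [k]; conversely, adjacent links meet and each has
    diameter at most [e / 2], which bounds the mesh. *)
Lemma fine_chain (e : R) : chainable P -> 0 < e ->
  exists (M : nat) (k : P -> nat), [/\ coarse d k, onto_upto M k & mesh k e].
Proof.
move=> ch e0.
have e40 : 0 < e / 4 by rewrite divr_gt0.
have [m [c cov]] := finite_ball_cover e40.
have [|n [U [Uo Uc Ur Ui]]] := ch m _ _ cov; first by move=> i; exact: (dist_ball_open dM).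
have [r r0 rU] := open_cover_lebesgue Uo Uc.
have [k kP] := choice rU.
have Uk x : U (k x) x by apply: kP => /=; rewrite (distxx dM).
have diam i x y : U i x -> U i y -> d x y < e / 2.
  have [j Uj] := Ur i; move=> /Uj/= jx /Uj/= jy.
  by have := dist_triangle dM x (c j) y; rewrite (dist_sym dM x (c j)); lra.
apply: (@coarse_normalize (fun x => k x) n).
- exists r => // x y xy; apply: (iffLR (Ui (k x) (k y)) _).1.
  by exists y; split=> //; exact: kP.
- by move=> x; exact: ltnW.
- move=> x y kxy kyx; have [z [xz yz]] := iffRL (Ui (k x) (k y)) (conj kxy kyx).
  have := diam _ x z (Uk x) xz; have := diam _ z y yz (Uk y).
  by have := dist_triangle dM x z y; lra.
Qed.

Lemma distn1 (a b : nat) : (a <= b.+1)%N -> (b <= a.+1)%N -> `|a%:R - b%:R| <= 1 :> R.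
Proof.
move=> ab ba; have : (a%:R <= b.+1%:R :> R) by rewrite ler_nat.
have : (b%:R <= a.+1%:R :> R) by rewrite ler_nat.
by rewrite -!natr1 ler_norml; lra.
Qed.

Lemma clamp_dist (p q a b c : R) : p <= q -> `|a - b| <= c ->
  `|Num.min q (Num.max p a) - Num.min q (Num.max p b)| <= c.
Proof.
move=> pq; rewrite !ler_norml => ab.
case: (leP p a) => pa; case: (leP p b) => pb; rewrite ?(min_r pq);
  try (case: (leP q a) => qa); try (case: (leP q b) => qb); lra.
Qed.

(** The numbers [k (xs j)] record how the finer chain is folded over [0..N]; any [k'] is lifted
    through this record. The refinement is chosen before [k'], so one refined walk serves all tuples
    that follow the coarse one. Clamping costs 1, lifting 2 and smoothing 1, so the bound 5 has
    slack. *)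
Lemma refine_coarse (k : P -> nat) (N : nat) (e : R) : hereditarily_indecomposable P ->
  chainable P -> 0 < e -> (3 <= N)%N -> coarse d k -> onto_upto N k ->
  exists (M : nat) (k2 : P -> nat) (xs : nat -> P),
    [/\ [/\ (3 <= M)%N, coarse d k2, onto_upto M k2 & mesh k2 e],
      forall j, (j <= M)%N -> k2 (xs j) = j
    & forall k', coarse d k' -> onto_upto N k' -> exists k2',
       [/\ coarse d k2', onto_upto M k2'
         & forall x, `|(k (xs (k2' x)))%:R - (k' x)%:R| <= 5 :> R]].
Proof.
move=> hi ch e0 N3 [r r0 rk] [kN kon].
have [|M [k2 [k2c k2on k2m]]] := fine_chain (e := Num.min e r) ch.
  by rewrite lt_min e0.
have [k2M k2on'] := k2on.
have k2r x y : (k2 x <= (k2 y).+1)%N -> (k2 y <= (k2 x).+1)%N -> (k x <= (k y).+1)%N.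
  by move=> h1 h2; apply: rk; have := k2m x y h1 h2; rewrite lt_min => /andP[].
have [xs xsP] : exists xs, forall j, (j <= M)%N -> k2 (xs j) = j.
  have xsj j : exists x, (j <= M)%N -> k2 x = j.
    have [jM|] := leqP j M; last by exists point.
    by have [x xj] := k2on' j jM; exists x.
  by have [xs xsP] := choice xsj; exists xs.
have [a0 a0E] := kon 0%N (leq0n _); have [a1 a1E] := kon N (leqnn _).
have M3 : (3 <= M)%N.
  (* With at most three links every point is in or next to the link [minn M 1], so [k] could vary by
     at most 2, while it takes the values 0 and [N]. *)
  rewrite leqNgt; apply/negP => M2.
  have [b bE] := k2on' (minn M 1) (geq_minl _ _).
  have := k2M a0; have := k2M a1 => ? ?.
  have := k2r a1 b; have := k2r b a0; nat_lia.
exists M, k2, xs; split=> //.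
  by split=> // x y ? ?; have := k2m x y; rewrite lt_min => /(_ _ _)/andP[].
move=> k' k'c [k'N k'on].
(* The sample point of the link of [a0] is only known to have [k] at most 1, and similarly at [a1].
   Clamping makes the end values exactly 1 and [N - 1] and extreme along the walk; [3 <= N] keeps
   them distinct. *)
pose v j : R := Num.min (N.-1)%:R (Num.max 1 (k (xs j))%:R).
have N1 : 1 < (N.-1)%:R :> R by rewrite ltr1n; nat_lia.
have vk j : `|v j - (k (xs j))%:R| <= 1.
  have := kN (xs j); rewrite -(ler_nat R) (_ : N = N.-1.+1); last nat_lia.
  have : (0 <= (k (xs j))%:R :> R) by rewrite ler0n.
  rewrite -natr1 /v ler_norml; case: (leP 1 (k (xs j))%:R) => ?; case: (leP (N.-1)%:R _) => ?; lra.
have vb j : 1 <= v j /\ v j <= (N.-1)%:R.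
  by rewrite /v; case: (leP 1 (k (xs j))%:R) => ?; case: (leP (N.-1)%:R _) => ?; lra.
have vS i j : (i <= M)%N -> (j <= M)%N -> (i <= j.+1)%N -> (j <= i.+1)%N -> `|v i - v j| <= 1.
  move=> iM jM ij ji.
  have h : `|(k (xs i))%:R - (k (xs j))%:R| <= 1 :> R.
    by apply: distn1; apply: k2r; rewrite !xsP.
  by apply: clamp_dist => //; exact: ltW.
have near_xs x : (k (xs (k2 x)) <= (k x).+1)%N /\ (k x <= (k (xs (k2 x))).+1)%N.
  by split; apply: k2r; rewrite xsP//; nat_lia.
have v0 : v (k2 a0) = 1.
  have [h _] := near_xs a0; have kle : (k (xs (k2 a0)))%:R <= 1 :> R by rewrite lern1; nat_lia.
  by rewrite /v (max_l kle) (min_r (ltW N1)).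
have v1 : v (k2 a1) = (N.-1)%:R.
  by have [_ h] := near_xs a1; rewrite /v min_l// le_max ler_nat; apply/orP; right; nat_lia.
have [m [w [w0 wm wM wS won]]] := covering_walk (k2M a0) (k2M a1).
have [s s0 k's] := k'c.
have [||g guc gk'] := @smoothing R P d dM (fun x => (k' x)%:R) N%:R 1 s ler01 s0.
- by move=> x; rewrite ger0_norm ?ler0n// ler_nat.
- by move=> x y xy; apply: distn1; apply: k's; rewrite // (dist_sym dM).
have [] := @lift_walk R P d dM cT hi g guc m (v \o w) 1 1 (N.-1)%:R ltr01 N1.
  split=> /=; rewrite ?w0 ?wm//.
  by move=> i im; have [h1 h2] := wS i im; apply: vS => //; apply: wM; nat_lia.
move=> kh [eta [eta0 khm khc khu khe]].
have [b0 b0E] := k'on 0%N (leq0n _); have [b1 b1E] := k'on N (leqnn _).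
have kh0 : kh b0 = 0%N by apply: (khe b0).1; have := (gk' b0).2; rewrite b0E/=; lra.
have kh1 : kh b1 = m.
  apply: (khe b1).2; have := (gk' b1).1; rewrite b1E (_ : N = N.-1.+1) /=; last nat_lia.
  by rewrite -natr1; lra.
have [_ khon] := coarse_onto dM coT khc khm kh0 kh1.
exists (w \o kh); split.
- exact (coarse_comp dM khc khm wS).
- split=> [x|j /won[t /khon[x <-] <-]]; [exact: wM | by exists x].
- move=> x /=; have := vk (w (kh x)).
  have N1E : N%:R = (N.-1)%:R + 1 :> R by rewrite natr1; congr (_%:R); nat_lia.
  have k'x : 0 <= (k' x)%:R :> R /\ (k' x)%:R <= N%:R :> R by rewrite ler0n ler_nat.
  have [g1 g2] := gk' x.
  have [gp|gp] := leP (g x) 1.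
    have -> : kh x = 0%N by apply: (khe x).1; lra.
    by rewrite w0 v0 !ler_norml; lra.
  have [gq|gq] := leP (N.-1)%:R (g x).
    have -> : kh x = m by apply: (khe x).2; lra.
    by rewrite wm v1 !ler_norml; lra.
  have := khu x (ltW gp) (ltW gq); rewrite /= !ler_norml; lra.
Qed.

End Chains.

Definition renaming (G H : seq ball_sort) := forall k, var G k -> var H k.

(** * Renaming and transfer of formulas *)

Lemma var_case (j : ball_sort) (G : seq ball_sort) (Q : forall k, var (j :: G) k -> Prop) :
  Q j (var0 G j) -> (forall k v, Q k (varS j v)) -> forall k v, Q k v.
Proof.
move=> Q0 QS k v.
exact (match v in var G0 k0 return
  (match G0 return var G0 k0 -> Prop with
   | [::] => fun=> True
   | j0 :: G1 => fun v0 => forall Q' : (forall k, var (j0 :: G1) k -> Prop),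
       Q' j0 (var0 G1 j0) -> (forall k v, Q' k (varS j0 v)) -> Q' k0 v0
   end) v
with
| var0 _ _ => fun Q' h _ => h
| varS _ _ _ v' => fun Q' _ h => h _ v'
end Q Q0 QS).
Qed.

Definition lift_renaming G H (j : ball_sort) (w : renaming G H) :
    renaming (j :: G) (j :: H) := fun k v =>
  match v in var G0 k0
    return match G0 with [::] => unit | j0 :: G1 => renaming G1 H -> var (j0 :: H) k0 end
  with
  | var0 G1 k1 => fun=> var0 H k1
  | varS G1 j1 k1 v' => fun w' => varS j1 (w' k1 v')
  end w.

Section Renaming.
Context (R : realType).

Fixpoint mkenv (A : cstarType R) (G : seq ball_sort) :
    (forall k, var G k -> cball A k) -> env A G :=
  match G with
  | [::] => fun=> tt
  | k :: G' => fun F => (F k (var0 G' k), mkenv (fun j v => F j (varS k v)))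
  end.

Lemma lookup_mkenv (A : cstarType R) G (F : forall k, var G k -> cball A k) k (v : var G k) :
  lookup v (mkenv F) = F k v.
Proof. by elim: v F => [//|H j l v IH] F /=; rewrite IH. Qed.

Lemma env_ext (A : cstarType R) G (r s : env A G) :
  (forall k (v : var G k), lookup v r = lookup v s) -> r = s.
Proof.
elim: G r s => [[] []//|k G IH] [x r] [y s] rs; congr pair.
  exact: (rs k (var0 G k)).
by apply: IH => j v; exact: (rs j (varS k v)).
Qed.

Definition pull (A : cstarType R) G H (w : renaming G H) (r : env A H) : env A G :=
  mkenv (fun k v => lookup (w k v) r).

Lemma lookup_pull (A : cstarType R) G H (w : renaming G H) (r : env A H) k (v : var G k) :
  lookup v (pull w r) = lookup (w k v) r.
Proof. exact: lookup_mkenv. Qed.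

Lemma rename_term G H (w : renaming G H) k (t : term R G k) :
  exists t' : term R H k, forall (A : cstarType R) (r : env A H),
    term_val t' r = term_val t (pull w r).
Proof.
elim: t => {k} [k v|||m n t1 [u1 h1] t2 [u2 h2]|m n t1 [u1 h1] t2 [u2 h2]|
  c m n cmn t1 [u1 h1]|m t1 [u1 h1]|m n mn t1 [u1 h1]].
- by exists (tVar R (w k v)) => A r /=; rewrite lookup_pull.
- by exists (tZero R H).
- by exists (tOne R H).
- by exists (tAdd u1 u2) => A r /=; rewrite h1 h2.
- by exists (tMul u1 u2) => A r /=; rewrite h1 h2.
- by exists (tScale cmn u1) => A r /=; rewrite h1.
- by exists (tAdj u1) => A r /=; rewrite h1.
- by exists (tIncl mn u1) => A r /=; rewrite h1.
Qed.

Lemma rename_formula G (p : formula R G) H (w : renaming G H) :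
  exists q : formula R H, forall (A : cstarType R) (r : env A H),
    formula_val q r = formula_val p (pull w r).
Proof.
elim: p H w => {G} [G k t1 t2|G n u uc ps IH|G k p IH|G k p IH] H w.
- have [u1 h1] := rename_term w t1; have [u2 h2] := rename_term w t2.
  by exists (fDist u1 u2) => A r /=; rewrite h1 h2.
- have [qs qsP] := choice (fun i => IH i H w).
  exists (fConn uc qs) => A r /=; congr u; apply/rowP => i.
  by rewrite !mxE qsP.
- have [q qP] := IH _ (@lift_renaming _ _ k w); exists (fSup q) => A r /=.
  congr (sup _); apply/seteqP; split=> _ [x _ <-]; exists x => //.
- have [q qP] := IH _ (@lift_renaming _ _ k w); exists (fInf q) => A r /=.
  congr (inf _); apply/seteqP; split=> _ [x _ <-]; exists x => //.
Qed.

End Renaming.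

Fixpoint varl G H k (v : var H k) : var (H ++ G) k :=
  match v in var H k return var (H ++ G) k with
  | var0 H' k => var0 (H' ++ G) k
  | varS H' j k v' => varS j (varl G v')
  end.

Fixpoint varr G H k (v : var G k) : var (H ++ G) k :=
  match H return var (H ++ G) k with
  | [::] => v
  | j :: H' => varS j (varr H' v)
  end.

(** * Conjunctions, blocks of infima, the transfer principle and the game *)

Section Connectives.
Context (R : realType).

Fixpoint catenv (A : cstarType R) H G (h : env A H) (r : env A G) {struct H} : env A (H ++ G) :=
  match H return env A H -> env A (H ++ G) with
  | [::] => fun=> r
  | k :: H' => fun h => (h.1, catenv h.2 r)
  end h.

Lemma lookup_varl (A : cstarType R) H G (h : env A H) (r : env A G) k (v : var H k) :
  lookup (varl G v) (catenv h r) = lookup v h.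
Proof. by elim: v h => [//|H' j l v IH] h /=; rewrite IH. Qed.

Lemma lookup_varr (A : cstarType R) H G (h : env A H) (r : env A G) k (v : var G k) :
  lookup (varr H v) (catenv h r) = lookup v r.
Proof. by elim: H h => [//|j H IH] h /=; rewrite IH. Qed.

Lemma pull_varl (A : cstarType R) H G (h : env A H) (r : env A G) :
  pull (fun k v => @varl G H k v) (catenv h r) = h.
Proof. by apply: env_ext => k v; rewrite lookup_pull lookup_varl. Qed.

Lemma fDist_varE (A : cstarType R) H G (h : env A H) (r : env A G) k
    (v : var H k) (w : var G k) :
  formula_val (fDist (tVar R (varl G v)) (tVar R (varr H w))) (catenv h r) =
  cnorm (sval (lookup v h) - sval (lookup w r)).
Proof. by rewrite /= lookup_varl lookup_varr. Qed.

Lemma affine_continuous (a b : R) : continuous (fun w : 'rV[R]_1 => a * w ord0 ord0 + b).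
Proof.
move=> w; apply: (@continuousD _ _ _ (fun w : 'rV[R]_1 => a * w ord0 ord0) (fun=> b)).
  apply: (@continuousM _ _ (fun=> a) (fun w : 'rV[R]_1 => w ord0 ord0)).
    exact: cst_continuous.
  exact: coord_continuous.
exact: cst_continuous.
Qed.

Lemma max_continuous :
  continuous (fun w : 'rV[R]_2 => Num.max (w ord0 ord0) (w ord0 ord_max)).
Proof. by move=> w; apply: continuous_max; exact: coord_continuous. Qed.

Lemma const_continuous (c : R) : continuous (fun w : 'rV[R]_0 => c).
Proof. by move=> w; exact: cst_continuous. Qed.

Definition fAffine G (a b : R) (p : formula R G) : formula R G :=
  fConn (@affine_continuous a b) (fun=> p).

Definition fMax G (p q : formula R G) : formula R G :=
  fConn (@max_continuous) (fun i => if i == ord0 then p else q).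

Definition fConst G (c : R) : formula R G :=
  fConn (@const_continuous c) (fun=> fDist (tZero R G) (tZero R G)).

Lemma fAffineE A G a b (p : formula R G) (r : env A G) :
  formula_val (fAffine a b p) r = a * formula_val p r + b.
Proof. by rewrite /= mxE. Qed.

Lemma fMaxE A G (p q : formula R G) (r : env A G) :
  formula_val (fMax p q) r = Num.max (formula_val p r) (formula_val q r).
Proof. by rewrite /= !mxE. Qed.

Lemma fMax_lt A G (p q : formula R G) (r : env A G) c :
  formula_val (fMax p q) r < c <-> formula_val p r < c /\ formula_val q r < c.
Proof. by rewrite fMaxE gt_max; split=> [/andP|[-> ->]]. Qed.

Lemma fMax_le A G (p q : formula R G) (r : env A G) c :
  formula_val p r <= c -> formula_val q r <= c -> formula_val (fMax p q) r <= c.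
Proof. by rewrite fMaxE ge_max => -> ->. Qed.

Lemma fConstE A G c (r : env A G) : formula_val (fConst G c) r = c.
Proof. by []. Qed.

Definition fNorm G k (t : term R G k) : formula R G :=
  fDist t (tIncl (radius_gt0 k : (sort1 <= k)%N) (tZero R G)).

Lemma fNormE A G k (t : term R G k) (r : env A G) :
  formula_val (fNorm t) r = cnorm (sval (term_val t r)).
Proof. by rewrite /= subr0. Qed.

(** The empty conjunction is -1, which counts as true for both thresholds, [< 1] and [<= 0]. *)
Fixpoint fAll G (n : nat) (F : nat -> formula R G) : formula R G :=
  if n is n'.+1 then fMax (fAll n' F) (F n') else fConst G (-1).

Lemma fAll_lt A G n F (r : env A G) :
  formula_val (fAll n F) r < 1 <-> forall i, (i < n)%N -> formula_val (F i) r < 1.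
Proof.
elim: n => [|n IH]; first by rewrite fConstE; split=> // _; lra.
rewrite (fMaxE (fAll n F) (F n)) gt_max.
split=> [/andP[/IH h1 h2] i|h].
  by rewrite ltnS leq_eqVlt => /orP[/eqP->//|]; exact: h1.
by apply/andP; split; [apply/IH => i ni; apply: h; exact: ltnW | exact: h].
Qed.

Lemma fAll_le A G n F (r : env A G) :
  (forall i, (i < n)%N -> formula_val (F i) r <= 0) -> formula_val (fAll n F) r <= 0.
Proof.
elim: n => [|n IH] h; first by rewrite fConstE; lra.
rewrite (fMaxE (fAll n F) (F n)) ge_max.
by apply/andP; split; [apply/IH => i ni; apply: h; exact: ltnW | exact: h].
Qed.

Fixpoint fAllV G H : (forall k, var H k -> formula R G) -> formula R G :=
  match H with
  | [::] => fun=> fConst G (-1)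
  | k :: H' => fun F => fMax (F k (var0 H' k)) (fAllV (fun j v => F j (varS k v)))
  end.

Lemma fAllV_lt A G H F (r : env A G) :
  formula_val (@fAllV G H F) r < 1 <-> forall k v, formula_val (F k v) r < 1.
Proof.
elim: H F => [|k H IH] F.
  by rewrite fConstE; split=> [_ k v|_]; [inversion v | lra].
rewrite (fMaxE (F k (var0 H k)) (fAllV (fun j v => F j (varS k v)))) gt_max.
split=> [/andP[h1 /IH h2] j v|h].
  exact: (var_case (Q := fun j v => formula_val (F j v) r < 1)).
by apply/andP; split=> //; apply/IH.
Qed.

Lemma fAllV_le A G H F (r : env A G) :
  (forall k v, formula_val (F k v) r <= 0) -> formula_val (@fAllV G H F) r <= 0.
Proof.
elim: H F => [|k H IH] F h; first by rewrite fConstE; lra.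
rewrite (fMaxE (F k (var0 H k)) (fAllV (fun j v => F j (varS k v)))) ge_max.
by apply/andP; split=> //; apply: IH.
Qed.

Fixpoint fInfs H G : formula R (H ++ G) -> formula R G :=
  match H return formula R (H ++ G) -> formula R G with
  | [::] => id
  | k :: H' => fun p => fInfs (fInf p)
  end.

Lemma quant_bounded A G k (p : formula R (k :: G)) (r : env A G) :
  has_lbound [set formula_val p ((x, r) : env A (k :: G)) | x in [set: cball A k]] /\
  has_ubound [set formula_val p ((x, r) : env A (k :: G)) | x in [set: cball A k]].
Proof.
have [M pM] := formula_val_bounded A p.
split; [exists (- M) | exists M] => _ [x _ <-];
  by have := pM (x, r); rewrite ler_norml => /andP[].
Qed.

Lemma fInfs_le A H G (p : formula R (H ++ G)) (h : env A H) (r : env A G) :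
  formula_val (fInfs p) r <= formula_val p (catenv h r).
Proof.
elim: H p h => [//|k H IH] p [x h] /=.
apply: le_trans (IH _ h) _; apply: ge_inf; last by exists x.
by have [] := quant_bounded p (catenv h r).
Qed.

Lemma fInfs_lt A H G (p : formula R (H ++ G)) (r : env A G) c :
  formula_val (fInfs p) r < c -> exists h : env A H, formula_val p (catenv h r) < c.
Proof.
elim: H p => [|k H IH] p /=; first by exists tt.
move=> /IH[h] /inf_lt[|_ [x _ <-] xc].
  by have [x _] := cball_inhabited A k; exists (formula_val p (x, catenv h r)), x.
by exists (x, h).
Qed.

(** A counterexample makes the sentence [inf max(p - 1, -q)] negative, and conversely a negative
    infimum has a witness. The strict inequalities [p < 1] and [0 < q] are what makes this an
    equivalence. *)
Lemma transfer (A B : cstarType R) (AB : elementarily_equivalent A B) G (p q : formula R G) :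
  (forall r : env A G, formula_val p r < 1 -> formula_val q r <= 0) ->
  forall r : env B G, formula_val p r < 1 -> formula_val q r <= 0.
Proof.
move=> pq r pr; rewrite leNgt; apply/negP => qr.
pose s := fMax (fAffine 1 (-1) p) (fAffine (-1) 0 q).
(* The block of infima expects the context [G ++ [::]], which is not convertible to [G]. *)
have [s' s'P] := rename_formula s (fun k v => @varl [::] G k v).
have sE (C : cstarType R) (u : env C G) : formula_val s u < 0 <->
    formula_val p u < 1 /\ 0 < formula_val q u.
  rewrite fMaxE gt_max !fAffineE; split=> [/andP[]|[]]; first by lra.
  by move=> h1 h2; apply/andP; lra.
have : formula_val (fInfs s') (tt : env B [::]) < 0.
  apply: le_lt_trans (fInfs_le s' r tt) _.
  by rewrite s'P pull_varl; apply/sE.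
rewrite -AB => /fInfs_lt[h]; rewrite s'P pull_varl => /sE[/pq].
by rewrite leNgt => /negP.
Qed.

Lemma connective_unif_cont n (u : 'rV[R]_n -> R) (M : 'I_n -> R) (e : R) :
  continuous u -> 0 < e -> exists2 r : R, 0 < r & forall v w : 'rV[R]_n,
    (forall i, `|v ord0 i| <= M i) -> (forall i, `|v ord0 i - w ord0 i| <= r) ->
    `|u v - u w| <= e.
Proof.
move=> uc e0.
have cK : compact [set v : 'rV[R]_n | forall i, v ord0 i \in `[- M i, M i]].
  by apply: (@rV_compact _ _ (fun i => `[- M i, M i]%classic)) => i; exact: segment_compact.
have := (compact_near_coveringP _).1 cK nat \oo
  (fun N v => forall w : 'rV[R]_n, (forall i, `|v ord0 i - w ord0 i| <= N.+1%:R^-1) ->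
     `|u v - u w| <= e) _.
case.
  move=> v _ /=.
  have e20 : 0 < e / 2 by rewrite divr_gt0.
  have /cvgrPdist_lt/(_ _ e20)/nbhs_ballP[h /= h0 hu] := uc v.
  have h20 : 0 < h / 2 by rewrite divr_gt0.
  exists (ball v (h / 2), [set N | (N.+1%:R^-1 : R) < h / 2]).
    split=> /=; first by apply/nbhs_ballP; exists (h / 2).
    exact: (near_infty_natSinv_lt (PosNum h20)).
  move=> [v' N] /= [vv' Nh] w v'w.
  have h1 : `|u v - u v'| < e / 2.
    by apply: hu; apply: le_ball vv'; lra.
  have h2 : `|u v - u w| < e / 2.
    apply: hu; split=> // i j; rewrite ord1.
    have close (a b c h' : R) : h' < h / 2 -> `|a - b| < h / 2 -> `|b - c| <= h' ->
      `|a - c| < h by rewrite !ltr_norml !ler_norml; lra.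
    exact: close Nh (vv'.2 ord0 j) (v'w j).
  by move: h1 h2; rewrite !ltr_norml ler_norml; lra.
move=> N _ NK; exists N.+1%:R^-1; first by rewrite invr_gt0.
move=> v w vM vw; apply: NK vw; first exact: leqnn.
by move=> i; rewrite in_itv/= -ler_norml.
Qed.

(* An Ehrenfeucht-Fraisse game, in approximate form. *)
Lemma back_and_forth (A : cstarType R) (E : forall G, R -> env A G -> env A G -> Prop) :
  (forall G (e e' : R) r s, e <= e' -> E G e r s -> E G e' r s) ->
  (forall G (e : R) r s, E G e r s -> E G e s r) ->
  (forall G k (t1 t2 : term R G k) (e : R), 0 < e -> exists2 z : R, 0 < z &
    forall r s, E G z r s ->
      cnorm (sval (term_val t1 r) - sval (term_val t2 r)) <=
      cnorm (sval (term_val t1 s) - sval (term_val t2 s)) + e) ->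
  (forall G k (e : R), 0 < e -> exists2 z : R, 0 < z & forall r s, E G z r s ->
    forall x : cball A k, exists y : cball A k, E (k :: G) e (x, r) (y, s)) ->
  forall G (p : formula R G) (e : R), 0 < e -> exists2 z : R, 0 < z &
    forall r s, E G z r s -> `|formula_val p r - formula_val p s| <= e.
Proof.
move=> Ele Esym Eterm Ebf G p.
have half (G' : seq ball_sort) (F : env A G' -> R) (e : R) : (exists2 z : R, 0 < z &
    forall r s, E G' z r s -> F r <= F s + e) ->
    exists2 z : R, 0 < z & forall r s, E G' z r s -> `|F r - F s| <= e.
  move=> [z z0 zF]; exists z => // r s rs; have := zF _ _ rs; have := zF _ _ (Esym _ _ _ _ rs).
  by rewrite ler_norml; lra.
elim: p => {G} [G k t1 t2|G n u uc ps IH|G k q IH|G k q IH] e e0; apply: half => //=.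
- exact: Eterm.
- have [M psM] := choice (fun i => formula_val_bounded A (ps i)).
  have [h h0 hu] := connective_unif_cont M uc e0.
  have IHh i : exists z, 0 < z /\ forall r s, E G z r s ->
      `|formula_val (ps i) r - formula_val (ps i) s| <= h.
    by have [z ? ?] := IH i h h0; exists z.
  have [z zP] := choice IHh.
  have [z0 z00 zz] : exists2 z0 : R, 0 < z0 & forall i, z0 <= z i.
    exists (\big[Num.min/1]_i z i); last by move=> i; exact: bigmin_le_cond.
    by apply/bigmin_gtP; split=> // i _; case: (zP i).
  exists z0 => // r s rs; rewrite -lerBlDl; apply: le_trans (ler_norm _) _.
  apply: hu => i; rewrite !mxE; first exact: psM.
  by apply: (zP i).2; exact: Ele rs.
- have [z0 z00 qz] := IH e e0; have [z z0' zE] := Ebf G k z0 z00.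
  exists z => // r s /zE rs; apply: ge_sup.
    by have [x _] := cball_inhabited A k; exists (formula_val q (x, r)), x.
  move=> _ [x _ <-]; have [y /qz xy] := rs x.
  have : formula_val q (y, s) <= sup [set formula_val q (x0, s) | x0 in [set: cball A k]].
    by apply: ub_le_sup; [have [] := quant_bounded q s | exists y].
  by move: xy; rewrite ler_norml; lra.
- have [z0 z00 qz] := IH e e0; have [z z0' zE] := Ebf G k z0 z00.
  exists z => // r s /Esym/zE sr; rewrite -lerBlDr; apply: lb_le_inf.
    by have [x _] := cball_inhabited A k; exists (formula_val q (x, s)), x.
  move=> _ [x _ <-]; have [y /qz xy] := sr x.
  have : inf [set formula_val q (x0, r) | x0 in [set: cball A k]] <= formula_val q (y, r).
    by apply: ge_inf; [have [] := quant_bounded q r | exists y].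
  by move: xy; rewrite ler_norml; lra.
Qed.

End Connectives.

(** * The algebra C(P) *)

Section NormC.
Context (R : realType).
Implicit Types a b c : R[i].

Lemma normc_triangle a b c : normc (a - c) <= normc (a - b) + normc (b - c).
Proof. by rewrite -[a - c](subrKA b); exact: normcD. Qed.

Lemma normc_le_dist a b : normc a <= normc b + normc (a - b).
Proof. by rewrite -{1}(subrK b a) addrC [leRHS]addrC; rewrite addrC normcD. Qed.

Lemma normc_prod (I : Type) (s : seq I) (F : I -> R[i]) :
  normc (\prod_(i <- s) F i) = \prod_(i <- s) normc (F i).
Proof.
elim: s => [|i s IH]; first by rewrite !big_nil normc1.
by rewrite !big_cons normcM IH.
Qed.

Lemma prod_small (n : nat) (F : nat -> R) (c : R) : 0 <= c ->
  \prod_(i < n) F i < c ^+ n -> exists2 i, (i < n)%N & F i < c.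
Proof.
move=> c0 Fc; apply: contrapT => h.
have cF i : (i < n)%N -> c <= F i.
  by move=> ni; rewrite leNgt; apply/negP => Fi; apply: h; exists i.
move: Fc; rewrite ltNge => /negP; apply.
rewrite -[X in c ^+ X](card_ord n) -prodr_const; apply: ler_prod => i _.
by rewrite c0/= cF.
Qed.

Lemma walk_dist (N : nat) (v : nat -> R[i]) (z : R) : 0 <= z ->
  (forall i, (i < N)%N -> normc (v i.+1 - v i) <= z) ->
  forall a b : nat, (a <= N)%N -> (b <= N)%N -> normc (v a - v b) <= `|a%:R - b%:R| * z.
Proof.
move=> z0 vz.
have le_ab (a b : nat) : (a <= b)%N -> (b <= N)%N -> normc (v b - v a) <= (b%:R - a%:R) * z.
  elim: b => [|b IH]; first by rewrite leqn0 => /eqP -> _; rewrite !subrr normc0 mul0r.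
  rewrite leq_eqVlt => /orP[/eqP-> _|ab bN]; first by rewrite !subrr normc0 mul0r.
  apply: le_trans (normc_triangle _ (v b) _) _.
  by have := IH ab (ltnW bN); have := vz _ bN; rewrite -natr1; nra.
move=> a b aN bN; have [ab|/ltnW ba] := leqP a b.
  by rewrite normc_subC distrC ger0_norm ?subr_ge0 ?ler_nat// le_ab.
by rewrite ger0_norm ?subr_ge0 ?ler_nat// le_ab.
Qed.

End NormC.

Section CP.
Context (R : realType) (P : continuumType) (d : P -> P -> R).
Context (dM : metric_of d).
Local Notation CP := (contC R P : cstarType R).

Definition ev k (f : cball CP k) (x : P) : R[i] := contC_fun (sval f) x.

Lemma cnorm_le_ev (f : CP) (M : R) : (forall x, normc (contC_fun f x) <= M) -> cnorm f <= M.
Proof. exact: supnorm_le. Qed.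

Lemma ev_le_cnorm (f : CP) x : normc (contC_fun f x) <= cnorm f.
Proof. exact: supnorm_ub. Qed.

Lemma ev_bound k (f : cball CP k) x : normc (ev f x) <= k%:R.
Proof. by apply: le_trans (ev_le_cnorm _ _) _; case: f. Qed.

Lemma cnorm_gt_ev (f : CP) (c : R) : c < cnorm f -> exists x, c < normc (contC_fun f x).
Proof.
move=> cf; apply: contrapT => /forallNP h.
by move: cf; rewrite ltNge => /negP; apply; apply: cnorm_le_ev => x; rewrite leNgt; apply/negP.
Qed.

Lemma ev_unif_cont k (f : cball CP k) (e : R) : 0 < e ->
  exists2 r : R, 0 < r & forall x y, d x y < r -> normc (ev f x - ev f y) < e.
Proof.
move=> e0; apply: (lebesgue_number dM continuum_compact) => x.
have e20 : 0 < e / 2 by rewrite divr_gt0.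
have := iffLR (continuous_normcP (contC_fun (sval f))) (@contC_cts _ _ (sval f)) x _ e20.
move=> /(nbhs_distP dM)[r r0 rf]; exists r => // y z /rf/= xy /rf/= xz.
apply: le_lt_trans (normc_triangle _ (ev f x) _) _.
by rewrite normc_subC; move: xy xz; rewrite /ev; lra.
Qed.

Lemma env_unif_cont G (r : env CP G) (e : R) : 0 < e ->
  exists2 h : R, 0 < h & forall k (v : var G k) x y, d x y < h ->
    normc (ev (lookup v r) x - ev (lookup v r) y) < e.
Proof.
move=> e0; elim: G r => [|k G IH] r; first by exists 1 => // k v; inversion v.
have [h1 h10 rh1] := ev_unif_cont r.1 e0; have [h2 h20 rh2] := IH r.2.
exists (Num.min h1 h2); first by rewrite lt_min h10.
move=> l v; move: l v; apply: var_case => [|l v] x y; rewrite lt_min => /andP[? ?].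
  exact: rh1.
exact: rh2.
Qed.

Lemma unif_cont_ball (g1 g2 : P -> R) (k : ball_sort) : unif_cont d g1 -> unif_cont d g2 ->
  (forall x, normc (g1 x +i* g2 x) <= k%:R) ->
  exists f : cball CP k, forall x, ev f x = g1 x +i* g2 x.
Proof.
move=> g1c g2c gk.
have fc : continuous ((fun x => g1 x +i* g2 x) : P -> R[i]^o).
  apply/continuous_normcP => x e e0.
  have e20 : 0 < e / 2 by rewrite divr_gt0.
  have [h1 h10 gh1] := g1c _ e20; have [h2 h20 gh2] := g2c _ e20.
  apply/(nbhs_distP dM); exists (Num.min h1 h2); first by rewrite lt_min h10.
  move=> y /=; rewrite lt_min => /andP[/gh1 xy1 /gh2 xy2].
  suff : normc ((g1 x - g1 y) +i* (g2 x - g2 y)) < e by [].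
  apply: le_lt_trans (normc_le _) _ => /=.
  by rewrite (splitr e) ltrD.
have fk : cnorm (mkC fc : CP) <= k%:R by apply: cnorm_le_ev.
by exists (mkball fk).
Qed.

(** Smoothing the real and imaginary parts costs [z] each and may leave the ball of radius [k] by
    [2 * z]; scaling by [k / (k + 2 * z)] returns to the ball and costs another [2 * z]. *)
Lemma realize (psi : P -> R[i]) (k : ball_sort) (z e : R) : 0 <= z -> 0 < e ->
  (forall x, normc (psi x) <= k%:R) ->
  (forall x y, d x y < e -> normc (psi x - psi y) <= z) ->
  exists f : cball CP k, forall x, normc (ev f x - psi x) <= 4 * z.
Proof.
move=> z0 e0 psik psiz.
have [||g1 g1c g1P] := smoothing (psi := fun x => complex.Re (psi x)) dM (S := k%:R) z0 e0.
- by move=> x; apply: le_trans (normc_Re _) _.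
- by move=> x y /psiz; apply: le_trans; rewrite -raddfB; exact: normc_Re.
have [||g2 g2c g2P] := smoothing (psi := fun x => complex.Im (psi x)) dM (S := k%:R) z0 e0.
- by move=> x; apply: le_trans (normc_Im _) _.
- by move=> x y /psiz; apply: le_trans; rewrite -raddfB; exact: normc_Im.
have gpsi x : normc ((g1 x +i* g2 x) - psi x) <= 2 * z.
  apply: le_trans (normc_le _) _; have := g1P x; have := g2P x.
  case: (psi x) => a b /=.
  have h (u v : R) : u - z <= v -> v <= u -> `|v - u| <= z by rewrite ler_norml; lra.
  by move=> [? ?] [? ?]; have := h a (g1 x); have := h b (g2 x); lra.
have k0 : 0 < k%:R :> R by rewrite ltr0n; exact: radius_gt0.
have kz0 : 0 < k%:R + 2 * z by lra.
pose c := k%:R / (k%:R + 2 * z).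
have c0 : 0 <= c by rewrite divr_ge0 ?ltW.
have ckz : c * (k%:R + 2 * z) = k%:R by rewrite divfK// gt_eqF.
have c1 : c <= 1 by rewrite ler_pdivrMr//; lra.
have gk x : normc (g1 x +i* g2 x) <= k%:R + 2 * z.
  by apply: le_trans (normc_le_dist _ (psi x)) _; apply: lerD.
have scale_uc (g : P -> R) : unif_cont d g -> unif_cont d (fun x => c * g x).
  move=> gc r /gc[s s0 gs]; exists s => // x y /gs; rewrite -mulrBr normrM ger0_norm//.
  by apply: le_lt_trans; apply: ler_piMl.
have cE x : (c * g1 x) +i* (c * g2 x) = c%:C * (g1 x +i* g2 x).
  by apply/eqP; rewrite eq_complex /= !mul0r subr0 addr0 !eqxx.
have normcc (u : R) : 0 <= u -> normc u%:C = u.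
  by move=> u0; rewrite /= expr0n addr0 sqrtr_sqr ger0_norm.
have [|f fE] := @unif_cont_ball (fun x => c * g1 x) (fun x => c * g2 x) k
  (scale_uc _ g1c) (scale_uc _ g2c).
  by move=> x; rewrite cE normcM normcc// -ckz ler_wpM2l.
exists f => x; rewrite fE cE.
apply: le_trans (normc_triangle _ (g1 x +i* g2 x) _) _.
have -> : 4 * z = 2 * z + 2 * z by ring.
apply: lerD; last exact: gpsi.
rewrite normc_subC -{1}[g1 x +i* g2 x]mul1r -mulrBl normcM.
have -> : 1 - c%:C = (1 - c)%:C :> R[i] by rewrite raddfB.
rewrite normcc ?subr_ge0//.
apply: le_trans (_ : (1 - c) * (k%:R + 2 * z) <= _); first by rewrite ler_wpM2l// subr_ge0.
by rewrite mulrBl mul1r ckz; lra.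
Qed.

(** All operations of C(P) are pointwise. Two different points [x] and [y] are allowed because
    tuples with the same walk are compared at points of equal index, not at equal points. *)
Lemma term_pointwise G k (t : term R G k) (e : R) : 0 < e -> exists2 z : R, 0 < z &
  forall (r s : env CP G) x y,
    (forall l (v : var G l), normc (ev (lookup v r) x - ev (lookup v s) y) <= z) ->
    normc (ev (term_val t r) x - ev (term_val t s) y) <= e.
Proof.
elim: t e => {k} [k v|||m n t1 IH1 t2 IH2|m n t1 IH1 t2 IH2|c m n cmn t1 IH|m t IH|m n mn t IH] e e0.
- by exists e => // r s x y /(_ _ v).
- by exists 1 => // r s x y _; rewrite (_ : _ - _ = 0) ?normc0 ?ltW//; exact: subrr.
- by exists 1 => // r s x y _; rewrite (_ : _ - _ = 0) ?normc0 ?ltW//; exact: subrr.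
- have e20 : 0 < e / 2 by rewrite divr_gt0.
  have [z1 z10 h1] := IH1 _ e20; have [z2 z20 h2] := IH2 _ e20.
  exists (Num.min z1 z2); first by rewrite lt_min z10.
  move=> r s x y rs; have h1' : normc (ev (term_val t1 r) x - ev (term_val t1 s) y) <= e / 2.
    by apply: h1 => l v; apply: le_trans (rs l v) _; rewrite ge_min lexx.
  have h2' : normc (ev (term_val t2 r) x - ev (term_val t2 s) y) <= e / 2.
    by apply: h2 => l v; apply: le_trans (rs l v) _; rewrite ge_min lexx orbT.
  rewrite -[ev _ x]/(ev (term_val t1 r) x + ev (term_val t2 r) x).
  rewrite -[ev _ y]/(ev (term_val t1 s) y + ev (term_val t2 s) y).
  by rewrite opprD addrACA (splitr e); apply: le_trans (normcD _ _) _; exact: lerD.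
- have m0 : 0 < m%:R :> R by rewrite ltr0n; exact: radius_gt0.
  have n0 : 0 < n%:R :> R by rewrite ltr0n; exact: radius_gt0.
  have e10 : 0 < e / (2 * n%:R) by rewrite divr_gt0// mulr_gt0.
  have e20 : 0 < e / (2 * m%:R) by rewrite divr_gt0// mulr_gt0.
  have [z1 z10 h1] := IH1 _ e10; have [z2 z20 h2] := IH2 _ e20.
  exists (Num.min z1 z2); first by rewrite lt_min z10.
  move=> r s x y rs.
  have h1' : normc (ev (term_val t1 r) x - ev (term_val t1 s) y) <= e / (2 * n%:R).
    by apply: h1 => l v; apply: le_trans (rs l v) _; rewrite ge_min lexx.
  have h2' : normc (ev (term_val t2 r) x - ev (term_val t2 s) y) <= e / (2 * m%:R).
    by apply: h2 => l v; apply: le_trans (rs l v) _; rewrite ge_min lexx orbT.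
  rewrite -[ev _ x]/(ev (term_val t1 r) x * ev (term_val t2 r) x).
  rewrite -[ev _ y]/(ev (term_val t1 s) y * ev (term_val t2 s) y).
  have := ev_bound (term_val t1 s) y; have := ev_bound (term_val t2 r) x.
  move: h1' h2'; set a := ev _ x; set a' := ev _ y; set b := ev _ x; set b' := ev _ y.
  move=> h1' h2' bn am.
  have -> : a * b - a' * b' = (a - a') * b + a' * (b - b') by ring.
  apply: le_trans (normcD _ _) _; rewrite !normcM.
  have -> : e = e / (2 * n%:R) * n%:R + m%:R * (e / (2 * m%:R)).
    by field; rewrite !gt_eqF.
  by apply: lerD; apply: ler_pM => //; exact: normc_ge0.
- have c0 : 0 < normc c + 1 by rewrite ltr_wpDl// normc_ge0.
  have ec0 : 0 < e / (normc c + 1) by rewrite divr_gt0.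
  have [z z0 h] := IH _ ec0; exists z => // r s x y /h rs.
  rewrite -[ev _ x]/(c * ev (term_val t1 r) x) -[ev _ y]/(c * ev (term_val t1 s) y).
  rewrite -mulrBr normcM; have -> : e = (normc c + 1) * (e / (normc c + 1)).
    by field; rewrite gt_eqF.
  by apply: ler_pM => //; [exact: normc_ge0|exact: normc_ge0|lra].
- have [z z0 h] := IH _ e0; exists z => // r s x y /h.
  by rewrite -normc_conjcB.
- by have [z z0 h] := IH _ e0; exists z => // r s x y /h.
Qed.

End CP.

(** * Patterns *)

Section Patterns.
Context (R : realType) (P : continuumType) (d : P -> P -> R).
Context (dM : metric_of d).
Context (hi : hereditarily_indecomposable P) (ch : chainable P).
Local Notation CP := (contC R P : cstarType R).

(** Surjectivity of [k] gives tuples with a common walk nearly the same joint range, hence nearly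
    the same norms of terms. *)
Definition pattern G (z : R) (N : nat) (v : forall j, var G j -> nat -> R[i])
    (k : P -> nat) (r : env CP G) :=
  [/\ coarse d k, onto_upto N k,
      forall j (w : var G j) i, (i < N)%N -> normc (v j w i.+1 - v j w i) <= z
    & forall j (w : var G j) x, normc (ev (lookup w r) x - v j w (k x)) <= z].

Lemma pattern_le G z z' N v k (r : env CP G) :
  z <= z' -> pattern z N v k r -> pattern z' N v k r.
Proof.
by move=> zz' [kc kon vs rv]; split=> // [j w i iN|j w x]; apply: le_trans zz'; auto.
Qed.

Lemma realize_walk (w : nat -> R[i]) (j : ball_sort) (z : R) (N : nat) (k : P -> nat) :
  0 <= z -> coarse d k -> onto_upto N k -> (forall i, normc (w i) <= j%:R) ->
  (forall i, (i < N)%N -> normc (w i.+1 - w i) <= z) ->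
  exists f : cball CP j, forall x, normc (ev f x - w (k x)) <= 4 * z.
Proof.
move=> z0 [h h0 kh] [kN _] wj wz.
apply: (realize dM z0 h0) => [x|x y xy]; first exact: wj.
apply: le_trans (walk_dist z0 wz (kN x) (kN y)) _.
rewrite -[leRHS]mul1r ler_wpM2r//; apply: distn1; first exact: kh.
by apply: kh; rewrite (dist_sym dM).
Qed.

(** The refined walk lists the values of [(y, r)] at sample points. The factor 7 is 1 from [s] to
    the walk [v], 5 along [v] by [refine_coarse], and 1 from [v] back to [r]. *)
Lemma refine_pattern G j (y : cball CP j) (r : env CP G) N k z0 :
  0 < z0 -> (3 <= N)%N -> coarse d k -> onto_upto N k ->
  exists (M : nat) (k2 : P -> nat) (v2 : forall l, var (j :: G) l -> nat -> R[i]),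
  [/\ (3 <= M)%N, pattern z0 M v2 k2 ((y, r) : env CP (j :: G)),
      forall l (w : var (j :: G) l) i, normc (v2 l w i) <= l%:R
    & forall z v s k', pattern z N v k r -> pattern z N v k' s -> exists k2',
       [/\ coarse d k2', onto_upto M k2'
         & forall l (w : var G l) x, normc (ev (lookup w s) x - v2 l (varS j w) (k2' x)) <= 7 * z]].
Proof.
move=> z00 N3 kc kon.
have [h h0 hyr] := env_unif_cont dM ((y, r) : env CP (j :: G)) z00.
have [M [k2 [xs [[M3 k2c k2on k2m] xsP k2P]]]] := refine_coarse dM hi ch h0 N3 kc kon.
exists M, k2, (fun l w i => ev (lookup w ((y, r) : env CP (j :: G))) (xs i)); split=> //.
- have k2M := k2on.1; split=> // [l w i iM|l w x]; apply/ltW/hyr/k2m.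
  + by rewrite !xsP// ltnW.
  + by rewrite !xsP ?(ltnW iM)// leqW.
  + by rewrite xsP.
  + by rewrite xsP.
- by move=> l w i; exact: ev_bound.
move=> z v s k' [_ _ vz rv] [k'c k'on _ sv].
have [k2' [k2'c k2'on k2'P]] := k2P _ k'c k'on.
exists k2'; split=> // l w x /=.
have z_ge0 : 0 <= z by apply: le_trans (sv l w x); exact: normc_ge0.
apply: le_trans (normc_triangle _ (v l w (k' x)) _) _.
apply: le_trans (lerD (sv l w x) (normc_triangle _ (v l w (k (xs (k2' x)))) _)) _.
rewrite (_ : 7 * z = z + (5 * z + z)); last by ring.
apply/lerD/lerD => //; last by rewrite normc_subC.
apply: le_trans (walk_dist z_ge0 (vz l w) (k'on.1 x) (kon.1 _)) _.
by rewrite ler_wpM2r// distrC.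
Qed.

Definition same_pattern G (z : R) (r s : env CP G) := exists N v k k',
  [/\ (3 <= N)%N, pattern z N v k r & pattern z N v k' s].

Lemma formula_pattern G (p : formula R G) (e : R) : 0 < e -> exists2 z : R, 0 < z &
  forall r s : env CP G, same_pattern z r s -> `|formula_val p r - formula_val p s| <= e.
Proof.
move: G p e; apply: (back_and_forth (E := same_pattern)).
- move=> G e e' r s ee' [N [v [k [k' [N3 kr ks]]]]].
  by exists N, v, k, k'; split=> //; exact: pattern_le ee' _.
- by move=> G e r s [N [v [k [k' [? ? ?]]]]]; exists N, v, k', k.
- move=> G k t1 t2 e e0.
  have e20 : 0 < e / 2 by rewrite divr_gt0.
  have [z1 z10 h1] := @term_pointwise _ P _ _ t1 _ e20.
  have [z2 z20 h2] := @term_pointwise _ P _ _ t2 _ e20.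
  exists (Num.min (z1 / 2) (z2 / 2)); first by rewrite lt_min !divr_gt0.
  set z := Num.min _ _.
  have zz1' : z <= z1 / 2 by rewrite /z ge_min lexx.
  have zz2' : z <= z2 / 2 by rewrite /z ge_min lexx orbT.
  have zz1 : z + z <= z1 by lra.
  have zz2 : z + z <= z2 by lra.
  move=> r s [N [v [k1 [k1' [_ [_ [k1N _] _ rv] [_ [_ k1'on] _ sv]]]]]].
  apply: cnorm_le_ev => x; have [x' x'x] := k1'on _ (k1N x).
  have rs l (w : var G l) : normc (ev (lookup w r) x - ev (lookup w s) x') <= z + z.
    apply: le_trans (normc_triangle _ (v l w (k1 x)) _) _; apply: lerD => //.
    by rewrite normc_subC -x'x.
  have {}h1 := h1 r s x x' (fun l w => le_trans (rs l w) zz1).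
  have {}h2 := h2 r s x x' (fun l w => le_trans (rs l w) zz2).
  have hs := ev_le_cnorm (sval (term_val t1 s) - sval (term_val t2 s)) x'.
  apply: (@le_trans _ _ (normc (ev (term_val t1 s) x' - ev (term_val t2 s) x') + e)); last first.
    by rewrite lerD2r.
  rewrite -[contC_fun _ x]/(ev (term_val t1 r) x - ev (term_val t2 r) x).
  apply: le_trans (normc_le_dist _ (ev (term_val t1 s) x' - ev (term_val t2 s) x')) _.
  rewrite lerD2l; move: h1 h2.
  move: (ev (term_val t1 r) x) (ev (term_val t2 r) x) => a b.
  move: (ev (term_val t1 s) x') (ev (term_val t2 s) x') => a' b' h1 h2.
  have -> : a - b - (a' - b') = (a - a') + (b' - b) by ring.
  by apply: le_trans (normcD _ _) _; rewrite (splitr e) lerD// normc_subC.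
- move=> G k e e0.
  (* The answer to [y] is the new coordinate of the refined walk, realized along [k2']. The divisor
     4 absorbs the loss in [realize_walk], and the 7 below that in [refine_pattern]. *)
  have e40 : 0 < e / 4 by rewrite divr_gt0.
  exists (e / 7); first by rewrite divr_gt0.
  move=> r s [N [v [k1 [k1' [N3 kr ks]]]]] y.
  have [k1c k1on _ _] := kr.
  have [M [k2 [v2 [M3 k2r v2b k2P]]]] := refine_pattern y r e40 N3 k1c k1on.
  have [k2' [k2'c k2'on k2's]] := k2P _ _ _ _ kr ks.
  have [_ _ v2s _] := k2r.
  have [y' y'P] := realize_walk (ltW e40) k2'c k2'on (v2b _ (var0 G k)) (v2s _ (var0 G k)).
  exists y', M, v2, k2, k2'; split=> //.
    by apply: pattern_le k2r; lra.
  split=> // [j w i iM|j w x]; first by apply: le_trans (v2s _ _ _ iM) _; lra.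
  move: j w; apply: var_case => [|j w] /=.
    by apply: le_trans (y'P x) _; lra.
  by apply: le_trans (k2's _ w x) _; lra.
Qed.

End Patterns.

(** * Patterns are expressible *)

(** The head of the context carries the index [N], matching [nenv]; an index above [N] falls through
    to the variable of index 0. *)
Fixpoint nvar (N j : nat) : var (nseq N.+1 sort1) sort1 :=
  match N return var (nseq N.+1 sort1) sort1 with
  | 0%N => var0 [::] sort1
  | N'.+1 => if j == N'.+1 then var0 (nseq N'.+1 sort1) sort1 else varS sort1 (nvar N' j)
  end.

Fixpoint nenv (R : realType) (A : cstarType R) (e : nat -> cball A sort1) (N : nat) :
    env A (nseq N sort1) :=
  match N return env A (nseq N sort1) with
  | 0%N => tt
  | N'.+1 => (e N', nenv e N')
  end.

Lemma lookup_nvar (R : realType) (A : cstarType R) (e : nat -> cball A sort1) N j :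
  (j <= N)%N -> lookup (nvar N j) (nenv e N.+1) = e j.
Proof.
elim: N => [|N IH]; first by rewrite leqn0 => /eqP->.
rewrite leq_eqVlt => /orP[/eqP->|jN]; first by rewrite [nvar _ _]/= eqxx.
by rewrite [nvar _ _]/= ltn_eqF//; exact: IH.
Qed.

Section Bumps.
Context (R : realType) (P : continuumType) (d : P -> P -> R).
Context (dM : metric_of d).
Local Notation CP := (contC R P : cstarType R).

(** Tent functions of the distance to the level sets of [k], of width [h / 2] for a modulus [h] of
    [k]. Two bumps that are nonzero at one point belong to level sets at distance below [h], hence
    to adjacent indices. *)
Lemma bumps N (k : P -> nat) : coarse d k -> onto_upto N k ->
  exists e : nat -> cball CP sort1,
  [/\ forall x, ev (e (k x)) x = 1,
      forall i x, (i <= N)%N -> ev (e i) x <> 0 -> (i <= (k x).+1)%N /\ (k x <= i.+1)%N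
    & forall i j x, (i <= N)%N -> (j <= N)%N -> (i.+2 <= j)%N -> ev (e i) x * ev (e j) x = 0].
Proof.
move=> [h h0 kh] [kN kon].
pose V i x := [set d x y | y in [set y | k y = i]].
pose D i x := inf (V i x).
have V0 i x : (i <= N)%N -> V i x !=set0.
  by move=> /kon[y yi]; exists (d x y), y.
have Vlb i x : has_lbound (V i x) by exists 0 => _ [y _ <-]; exact: dist_ge0.
have Dle i x y : k y = i -> D i x <= d x y by move=> ky; apply: ge_inf => //; exists y.
have Dge0 i x : (i <= N)%N -> 0 <= D i x.
  by move=> iN; apply: lb_le_inf; [exact: V0 | move=> _ [y _ <-]; exact: dist_ge0].
have DL i x y : (i <= N)%N -> D i x - D i y <= d x y.
  move=> iN; rewrite lerBlDr -lerBlDl; apply: lb_le_inf; first exact: V0.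
  move=> _ [w kw <-]; have := Dle i x w kw; have := dist_triangle dM x y w; lra.
have Dlt i x : (i <= N)%N -> D i x < h / 2 -> exists2 y, k y = i & d x y < h / 2.
  by move=> iN /inf_lt[|_ [y ky <-] xy]; [exact: V0 | exists y].
(* Beyond [N] the level set is empty and its infimum a default value; truncating the index keeps
   every bump uniformly continuous. *)
pose b i x := Num.max 0 (1 - 2 / h * D (minn i N) x).
have h2 : 0 < 2 / h by rewrite divr_gt0.
have b_uc i : unif_cont d (b i).
  move=> e e0; exists (e / (2 / h)) => [|x y]; first by rewrite divr_gt0.
  rewrite ltr_pdivlMr// mulrC => xy.
  have iN : (minn i N <= N)%N by exact: geq_minr.
  have scaled (a c w : R) : a - c <= w -> 2 / h * a - 2 / h * c <= 2 / h * w.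
    by rewrite -mulrBr ler_pM2l.
  have := scaled _ _ _ (DL _ x y iN); have := scaled _ _ _ (DL _ y x iN).
  have max_dist (a c : R) : `|a - c| < e -> `|Num.max 0 a - Num.max 0 c| < e.
    by rewrite !ltr_norml; case: (leP 0 a) => ?; case: (leP 0 c) => ?; lra.
  by rewrite (dist_sym dM y x) => ? ?; apply: max_dist; rewrite ltr_norml; lra.
have b01 i x : 0 <= b i x <= 1.
  rewrite /b le_max lexx/= ge_max ler01/=.
  have : 0 <= 2 / h * D (minn i N) x by apply: mulr_ge0; [exact: ltW|exact/Dge0/geq_minr].
  by lra.
have zero_uc : unif_cont d (fun=> 0 : R).
  by move=> e e0; exists 1 => // x y _; rewrite subrr normr0.
have normcb i x : normc (b i x +i* 0) = b i x.
  by rewrite /= expr0n addr0 sqrtr_sqr ger0_norm//; case/andP: (b01 i x).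
have eP i : exists f : cball CP sort1, forall x, ev f x = b i x +i* 0.
  apply: (unif_cont_ball dM) => // x; rewrite normcb.
  by case/andP: (b01 i x).
have [e eE] := choice eP.
have e0 i x : (i <= N)%N -> ev (e i) x <> 0 -> exists2 y, k y = i & d x y < h / 2.
  move=> iN ex; apply: Dlt => //; rewrite ltNge; apply/negP => hD; apply: ex.
  rewrite eE /b (minn_idPl iN) max_l//.
  rewrite -(ler_pM2l h2) in hD; have : 2 / h * (h / 2) = 1 by field; rewrite gt_eqF.
  by lra.
exists e; split.
- move=> x; rewrite eE /b (minn_idPl (kN x)).
  suff -> : D (k x) x = 0 by rewrite mulr0 subr0 max_r.
  apply/eqP; rewrite eq_le Dge0// andbT.
  by have := Dle (k x) x x erefl; rewrite (distxx dM).
- move=> i x iN /(e0 _ _ iN)[y <- xy]; split; last by apply: kh; lra.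
  by apply: kh; rewrite (dist_sym dM); lra.
- move=> i j x iN jN ij; apply: contrapT => /eqP.
  rewrite mulf_eq0 negb_or => /andP[/eqP ei /eqP ej].
  have [y ky xy] := e0 _ _ iN ei; have [y' ky' xy'] := e0 _ _ jN ej.
  suff : (k y' <= (k y).+1)%N by lia.
  by apply: kh; have := dist_triangle dM y' x y; rewrite (dist_sym dM y' x); lra.
Qed.

(** Assign to [x] an index whose bump exceeds 3/4 there. Nearby, this bump still exceeds 1/2, and a
    product of moduli above 3/4 and 1/2 exceeds 1/4, so the indices of close points are adjacent.
    The bump also divides out of the deviation, from [z / 4] to less than [z]. *)
Lemma bumps_pattern G N z (v : forall j, var G j -> nat -> R[i]) (r : env CP G)
    (e : nat -> cball CP sort1) : 0 < z -> (2 <= N)%N ->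
  (forall j (w : var G j) i, (i < N)%N -> normc (v j w i.+1 - v j w i) <= z) ->
  (forall x, exists2 i, (i < N.+1)%N & normc (1 - ev (e i) x) < 1 / 4) ->
  (forall i j x, (i <= N)%N -> (j <= N)%N -> (i.+2 <= j)%N ->
     normc (ev (e i) x * ev (e j) x) < 1 / 4) ->
  (forall l (w : var G l) i x, (i <= N)%N ->
     normc ((ev (lookup w r) x - v l w i) * ev (e i) x) < z / 4) ->
  (exists x, 3 / 4 < normc (ev (e 0%N) x)) -> (exists x, 3 / 4 < normc (ev (e N) x)) ->
  exists k, pattern d z N v k r.
Proof.
move=> z0 N2 vz e1 e2 e3 [x0 x0E] [xN xNE].
have big i j x : (i <= N)%N -> (j <= N)%N -> 3 / 4 < normc (ev (e i) x) ->
    1 / 2 < normc (ev (e j) x) -> (i <= j.+1)%N /\ (j <= i.+1)%N.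
  move=> iN jN ei ej; have eij : 1 / 4 < normc (ev (e i) x * ev (e j) x).
    rewrite normcM; nra.
  split; rewrite leqNgt; apply/negP => ij.
    by have := e2 j i x jN iN ij; rewrite mulrC; lra.
  by have := e2 i j x iN jN ij; lra.
(* The two end bumps have priority, so that the indices 0 and N are attained. *)
have kP x : exists i, [/\ (i <= N)%N, 3 / 4 < normc (ev (e i) x),
    3 / 4 < normc (ev (e 0%N) x) -> i = 0%N & 3 / 4 < normc (ev (e N) x) -> i = N].
  have [h0|h0] := ltP (3 / 4) (normc (ev (e 0%N) x)).
    exists 0%N; split=> // hN; have hN' : 1 / 2 < normc (ev (e N) x) by lra.
    by have [_] := big 0%N N x (leq0n _) (leqnn _) h0 hN'; nat_lia.
  have [hN|hN] := ltP (3 / 4) (normc (ev (e N) x)); first by exists N; split=> //; lra.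
  have [i iN ei] := e1 x.
  have ei' : 3 / 4 < normc (ev (e i) x).
    by have := normc_le_dist (1 : R[i]) (ev (e i) x); rewrite normc1; lra.
  by exists i; split=> // h; exfalso; lra.
have [k kk] := choice kP.
have kN x : (k x <= N)%N by case: (kk x).
have kc : coarse d k.
  have d0 : 0 < 1 / 12 :> R by lra.
  have [h h0 eh] : exists2 h : R, 0 < h & forall i x y, (i <= N)%N -> d x y < h ->
      normc (ev (e i) x - ev (e i) y) < 1 / 12.
    have [h h0 eh] := env_unif_cont dM (nenv e N.+1) d0; exists h => // i x y iN xy.
    by have := eh _ (nvar N i) x y xy; rewrite lookup_nvar.
  exists h => // x y xy.
  have [_ kx _ _] := kk x; have [_ ky _ _] := kk y.
  have kxy : 1 / 2 < normc (ev (e (k x)) y).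
    have := normc_le_dist (ev (e (k x)) x) (ev (e (k x)) y).
    by have := eh (k x) x y (kN x) xy; lra.
  by have [] := big (k y) (k x) y (kN y) (kN x) ky kxy.
exists k; split=> //.
  apply: (coarse_onto dM continuum_connected kc kN (x := x0) (y := xN)).
    by case: (kk x0) => _ _ h _; exact: h.
  by case: (kk xN) => _ _ _; apply.
move=> j w x; have [_ kx _ _] := kk x.
have := e3 j w (k x) x (kN x); rewrite normcM.
have := normc_ge0 (ev (lookup w r) x - v j w (k x)).
by move: (normc (_ - _)) kx => a kx a0; nra.
Qed.

End Bumps.

Section PatternFormula.
Context (R : realType) (G : seq ball_sort) (N : nat) (z : R).
Context (v : forall l, var G l -> nat -> R[i]).
Context (v_le : forall l (w : var G l) i, normc (v w i) <= l%:R).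
Let H : seq ball_sort := nseq N.+1 sort1 ++ G.

Definition bumpT (i : nat) : term R H sort1 := tVar R (varl G (nvar N i)).

Fact normcN1_le : normc (-1 : R[i]) * sort1%:R <= sort1%:R.
Proof. by rewrite normcN normc1 mul1r. Qed.

(** A sigma type, because each factor, a sum of two terms of radius 1, doubles the radius of the
    sort. *)
Fixpoint prodT (n : nat) : {k & term R H k} :=
  if n is n'.+1 then
    existT _ _ (tMul (projT2 (prodT n')) (tAdd (tOne R H) (tScale normcN1_le (bumpT n'))))
  else existT _ sort1 (tOne R H).

Fact shift_le l (w : var G l) i : normc (- v w i) * sort1%:R <= l%:R.
Proof. by rewrite normcN mulr1 v_le. Qed.

Definition deviationT l (w : var G l) (i : nat) :=
  tMul (tAdd (tVar R (varr (nseq N.+1 sort1) w)) (tScale (shift_le w i) (tOne R H))) (bumpT i).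

(** Points cannot be quantified over. That some bump is near 1 at every point becomes smallness of
    the product of all [1 - e i]: below [4^-(N+1)], some factor is below 1/4. That a bump is large
    somewhere becomes a lower bound for its norm. The coefficients turn [< 1] into the hypotheses of
    [bumps_pattern]. *)
Definition pattern_body : formula R H :=
  fMax (fMax (fAffine (4 ^+ N.+1) 0 (fNorm (projT2 (prodT N.+1))))
             (fAll N.+1 (fun i => fAll N.+1 (fun j =>
                if (i.+2 <= j)%N then fAffine 4 0 (fNorm (tMul (bumpT i) (bumpT j)))
                else fConst H (-1)))))
       (fMax (fAllV (fun l w => fAll N.+1 (fun i => fAffine (8 / z) (-1) (fNorm (deviationT w i)))))
             (fMax (fAffine (-4) 4 (fNorm (bumpT 0))) (fAffine (-4) 4 (fNorm (bumpT N))))).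

Context (P : continuumType) (d : P -> P -> R).
Context (dM : metric_of d).
Local Notation CP := (contC R P : cstarType R).

Lemma ev_prodT (s : env CP H) n x :
  ev (term_val (projT2 (prodT n)) s) x = \prod_(i < n) (1 - ev (term_val (bumpT i) s) x).
Proof.
elim: n => [|n IH]; first by rewrite big_ord0.
rewrite big_ord_recr /= -IH -[ev _ x]/(ev (term_val (projT2 (prodT n)) s) x *
  (1 + (-1) * ev (term_val (bumpT n) s) x)).
by rewrite mulN1r.
Qed.

Lemma ev_deviationT (s : env CP H) l (w : var G l) i x :
  ev (term_val (deviationT w i) s) x =
  (ev (lookup (varr (nseq N.+1 sort1) w) s) x - v w i) * ev (term_val (bumpT i) s) x.
Proof.
rewrite -[LHS]/((ev (lookup (varr (nseq N.+1 sort1) w) s) x + (- v w i) * 1) *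
  ev (term_val (bumpT i) s) x).
by rewrite mulr1.
Qed.

Lemma pattern_formula : 0 < z -> (2 <= N)%N ->
  (forall j (w : var G j) i, (i < N)%N -> normc (v w i.+1 - v w i) <= z / 16) ->
  exists X : formula R G,
    (forall r : env CP G, formula_val X r < 1 -> exists k, pattern d z N v k r) /\
    (forall (r : env CP G) k, coarse d k -> onto_upto N k ->
       (forall l (w : var G l) x, normc (ev (lookup w r) x - v w (k x)) <= z / 16) ->
       formula_val X r <= 0).
Proof.
move=> z0 N2 vz; exists (fInfs pattern_body); split=> [r|r k kc kon rv].
  move=> /fInfs_lt[h]; set s := catenv h r.
  move=> /fMax_lt[/fMax_lt[c1 c2] /fMax_lt[c3 /fMax_lt[c40 c4N]]].
  rewrite fAffineE fNormE in c1; rewrite fAffineE fNormE in c40; rewrite fAffineE fNormE in c4N.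
  pose e i := lookup (varl G (nvar N i)) s.
  have eE i x : ev (term_val (bumpT i) s) x = ev (e i) x by [].
  apply: (bumps_pattern dM (e := e)) => //.
  - by move=> j w i iN; apply: le_trans (vz _ _ _ iN) _; lra.
  - move=> x; apply: (@prod_small _ N.+1 (fun i => normc (1 - ev (e i) x)) (1 / 4)); first lra.
    rewrite -normc_prod -ev_prodT expr_div_n expr1n.
    rewrite ltr_pdivlMr ?exprn_gt0// mulrC.
    apply: le_lt_trans c1; rewrite addr0 ler_pM2l ?exprn_gt0//.
    exact: ev_le_cnorm.
  - move=> i j x iN jN ij.
    move/fAll_lt/(_ i iN)/fAll_lt/(_ j jN): c2.
    rewrite ij fAffineE fNormE addr0 => c.
    have := ev_le_cnorm (sval (term_val (tMul (bumpT i) (bumpT j)) s)) x.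
    rewrite -[contC_fun _ x]/(ev (e i) x * ev (e j) x); lra.
  - move=> l w i x iN.
    move/fAllV_lt/(_ l w)/fAll_lt/(_ i iN): c3.
    rewrite fAffineE fNormE => c.
    have := ev_le_cnorm (sval (term_val (deviationT w i) s)) x.
    rewrite -[contC_fun _ x]/(ev (term_val (deviationT w i) s) x) ev_deviationT lookup_varr eE.
    move=> h1; apply: le_lt_trans h1 _.
    have : 8 / z * cnorm (sval (term_val (deviationT w i) s)) < 2 by lra.
    by rewrite mulrAC ltr_pdivrMr// ; lra.
  - have [|x xE] := @cnorm_gt_ev _ _ (sval (term_val (bumpT 0) s)) (3 / 4); first by lra.
    by exists x.
  - have [|x xE] := @cnorm_gt_ev _ _ (sval (term_val (bumpT N) s)) (3 / 4); first by lra.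
    by exists x.
have [e [e1 e0 e2]] := bumps dM kc kon.
apply: le_trans (fInfs_le _ (nenv e N.+1) r) _; set s := catenv _ _.
have eE i x : (i <= N)%N -> ev (term_val (bumpT i) s) x = ev (e i) x.
  by move=> iN; rewrite /= lookup_varl lookup_nvar.
have [kN kon'] := kon.
have c4 i : (i <= N)%N -> 1 <= cnorm (sval (term_val (bumpT i) s)).
  move=> iN; have [x kx] := kon' i iN.
  apply: le_trans (ev_le_cnorm _ x); rewrite -[contC_fun _ x]/(ev (term_val (bumpT i) s) x).
  by rewrite eE// -kx e1 normc1.
apply: fMax_le; apply: fMax_le.
- rewrite fAffineE fNormE addr0 pmulr_rle0 ?exprn_gt0//; apply: cnorm_le_ev => x.
  rewrite -[contC_fun _ x]/(ev (term_val (projT2 (prodT N.+1)) s) x) ev_prodT.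
  have kx : (k x < N.+1)%N by rewrite ltnS kN.
  by rewrite (bigD1 (Ordinal kx))//= eE// e1 subrr mul0r normc0.
- apply: fAll_le => i iN; apply: fAll_le => j jN; case: ifP => ij; last by rewrite fConstE; lra.
  rewrite fAffineE fNormE addr0 pmulr_rle0//; apply: cnorm_le_ev => x.
  rewrite -[contC_fun _ x]/(ev (term_val (bumpT i) s) x * ev (term_val (bumpT j) s) x).
  by rewrite !eE// e2// normc0.
- apply: fAllV_le => l w; apply: fAll_le => i iN; rewrite fAffineE fNormE.
  (* One [z / 16] is the distance from the tuple to the walk and one a step of the walk to an
     adjacent index; at all other indices the bump vanishes. *)
  suff : cnorm (sval (term_val (deviationT w i) s)) <= z / 8.
    move=> c; rewrite subr_le0 mulrAC ler_pdivrMr//; lra.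
  apply: cnorm_le_ev => x.
  rewrite -[contC_fun _ x]/(ev (term_val (deviationT w i) s) x) ev_deviationT lookup_varr eE//.
  have [->|/eqP ei] := eqVneq (ev (e i) x) 0; first by rewrite mulr0 normc0; lra.
  have [ik ki] := e0 i x iN ei.
  have z16 : 0 <= z / 16 by lra.
  have vi : normc (v w (k x) - v w i) <= z / 16.
    apply: le_trans (walk_dist z16 (vz l w) (kN x) iN) _.
    by rewrite -[leRHS]mul1r ler_wpM2r//; apply: distn1.
  have := normc_triangle (ev (lookup w r) x) (v w (k x)) (v w i).
  have := rv l w x; rewrite normcM => h1 h2.
  have eb := ev_bound (e i) x.
  rewrite -[z / 8]mulr1; apply: ler_pM; rewrite ?normc_ge0//; first by lra.
- have c40 := c4 0%N (leq0n N); have c4N := c4 N (leqnn N).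
  by apply: fMax_le; rewrite fAffineE fNormE; lra.
Qed.

End PatternFormula.

(** * Uniform continuity of formulas *)

Section CStarStructures.
Context (R : realType) (A : cstarType R).

Lemma cnorm_triangle (x y z : A) : cnorm (x - z) <= cnorm (x - y) + cnorm (y - z).
Proof. by rewrite -[x - z](subrKA y); exact: cnormD. Qed.

Lemma cnorm_subC (x y : A) : cnorm (x - y) = cnorm (y - x).
Proof. by rewrite -cnormN opprB. Qed.

Lemma adjB (x y : A) : adj (x - y) = adj x - adj y.
Proof. by apply: (addIr (adj y)); rewrite -adjD !subrK. Qed.

Definition env_close G (z : R) (r s : env A G) :=
  forall l (w : var G l), cnorm (sval (lookup w r) - sval (lookup w s)) <= z.

Lemma term_unif_cont G k (t : term R G k) (e : R) : 0 < e -> exists2 z : R, 0 < z &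
  forall r s : env A G, env_close z r s ->
    cnorm (sval (term_val t r) - sval (term_val t s)) <= e.
Proof.
elim: t e => {k} [k v|||m n t1 IH1 t2 IH2|m n t1 IH1 t2 IH2|c m n cmn t1 IH|m t IH|m n mn t IH] e e0.
- by exists e => // r s /(_ _ v).
- by exists 1 => // r s _; rewrite subrr cnorm0 ltW.
- by exists 1 => // r s _; rewrite subrr cnorm0 ltW.
- have e20 : 0 < e / 2 by rewrite divr_gt0.
  have [z1 z10 h1] := IH1 _ e20; have [z2 z20 h2] := IH2 _ e20.
  exists (Num.min z1 z2); first by rewrite lt_min z10.
  move=> r s rs; rewrite /= opprD addrACA (splitr e); apply: le_trans (cnormD _ _) _.
  by apply: lerD; [apply: h1|apply: h2] => l v; apply: le_trans (rs l v) _;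
    rewrite ge_min lexx ?orbT.
- have m0 : 0 < m%:R :> R by rewrite ltr0n; exact: radius_gt0.
  have n0 : 0 < n%:R :> R by rewrite ltr0n; exact: radius_gt0.
  have e10 : 0 < e / (2 * n%:R) by rewrite divr_gt0// mulr_gt0.
  have e20 : 0 < e / (2 * m%:R) by rewrite divr_gt0// mulr_gt0.
  have [z1 z10 h1] := IH1 _ e10; have [z2 z20 h2] := IH2 _ e20.
  exists (Num.min z1 z2); first by rewrite lt_min z10.
  move=> r s rs /=.
  have {}h1 : cnorm (sval (term_val t1 r) - sval (term_val t1 s)) <= e / (2 * n%:R).
    by apply: h1 => l v; apply: le_trans (rs l v) _; rewrite ge_min lexx.
  have {}h2 : cnorm (sval (term_val t2 r) - sval (term_val t2 s)) <= e / (2 * m%:R).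
    by apply: h2 => l v; apply: le_trans (rs l v) _; rewrite ge_min lexx orbT.
  move: h1 h2; case: (term_val t1 r) => a /= _; case: (term_val t2 r) => b /= bn.
  case: (term_val t1 s) => a' /= am; case: (term_val t2 s) => b' /= _ h1 h2.
  have -> : a * b - a' * b' = (a - a') * b + a' * (b - b').
    by rewrite mulrBl mulrBr addrA subrK.
  have -> : e = e / (2 * n%:R) * n%:R + m%:R * (e / (2 * m%:R)).
    by field; rewrite !gt_eqF.
  apply: le_trans (cnormD _ _) _; apply: lerD; apply: le_trans (cnormM _ _) _;
    by apply: ler_pM => //; exact: cnorm_ge0.
- have c0 : 0 < normc c + 1 by rewrite ltr_wpDl// normc_ge0.
  have ec0 : 0 < e / (normc c + 1) by rewrite divr_gt0.
  have [z z0 h] := IH _ ec0; exists z => // r s /h rs /=.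
  rewrite -scalerBr cnormZ; have -> : e = (normc c + 1) * (e / (normc c + 1)).
    by field; rewrite gt_eqF.
  by apply: ler_pM => //; [exact: normc_ge0|exact: cnorm_ge0|lra].
- have [z z0 h] := IH _ e0; exists z => // r s /h /=.
  by rewrite -adjB cnorm_adj.
- by have [z z0 h] := IH _ e0; exists z => // r s /h.
Qed.

(** The same game with closeness of environments as the relation; the answer to [x] is [x]
    itself. *)
Lemma formula_unif_cont G (p : formula R G) (e : R) : 0 < e -> exists2 z : R, 0 < z &
  forall r s : env A G, env_close z r s -> `|formula_val p r - formula_val p s| <= e.
Proof.
move: G p e; apply: (back_and_forth (E := env_close)).
- by move=> G e e' r s ee' rs l w; exact: le_trans (rs l w) ee'.
- by move=> G e r s rs l w; rewrite cnorm_subC.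
- move=> G k t1 t2 e e0; have e20 : 0 < e / 2 by rewrite divr_gt0.
  have [z1 z10 h1] := term_unif_cont t1 e20; have [z2 z20 h2] := term_unif_cont t2 e20.
  exists (Num.min z1 z2); first by rewrite lt_min z10.
  move=> r s rs.
  have {}h1 : cnorm (sval (term_val t1 r) - sval (term_val t1 s)) <= e / 2.
    by apply: h1 => l v; apply: le_trans (rs l v) _; rewrite ge_min lexx.
  have {}h2 : cnorm (sval (term_val t2 r) - sval (term_val t2 s)) <= e / 2.
    by apply: h2 => l v; apply: le_trans (rs l v) _; rewrite ge_min lexx orbT.
  have := cnorm_triangle (sval (term_val t1 r)) (sval (term_val t1 s)) (sval (term_val t2 r)).
  have := cnorm_triangle (sval (term_val t1 s)) (sval (term_val t2 s)) (sval (term_val t2 r)).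
  by rewrite (cnorm_subC (sval (term_val t2 s))); lra.
- move=> G k e e0; exists e => // r s rs x; exists x => l w; move: l w.
  by apply: var_case => [|l w] /=; [rewrite subrr cnorm0 ltW | exact: rs].
Qed.

Lemma half_exp (n : nat) : 2^-1 ^+ n.+1 = 2^-1 ^+ n / 2 :> R.
Proof. by rewrite exprS mulrC. Qed.

Lemma half_exp_gt0 (n : nat) : 0 < 2^-1 ^+ n :> R.
Proof. by rewrite exprn_gt0// invr_gt0. Qed.

Lemma half_exp_le (m n : nat) : (m <= n)%N -> 2^-1 ^+ n <= 2^-1 ^+ m :> R.
Proof. by move=> mn; apply: ler_wiXn2l mn; lra. Qed.

Lemma half_exp_lt (e : R) : 0 < e -> exists n, 2^-1 ^+ n < e.
Proof.
move=> e0; have [N _ Ne] : \forall n \near \oo, (n.+1%:R^-1 : R) < e.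
  exact: (near_infty_natSinv_lt (PosNum e0)).
exists N; apply: le_lt_trans (Ne N (leqnn N)).
rewrite exprVn lef_pV2 ?posrE ?exprn_gt0 ?ltr0n// -natrX ler_nat.
exact: ltn_expl.
Qed.

Lemma geometric_limit k (u : nat -> cball A k) (C : R) :
  (forall j, cnorm (sval (u j.+1) - sval (u j)) <= C * 2^-1 ^+ j) ->
  exists c : cball A k, forall j, cnorm (sval (u j) - sval c) <= 2 * C * 2^-1 ^+ j.
Proof.
move=> uC.
have C0 : 0 <= C by have := uC 0%N; rewrite expr0 mulr1; apply: le_trans; exact: cnorm_ge0.
have tail j i : cnorm (sval (u (i + j)%N) - sval (u j)) <= 2 * C * (2^-1 ^+ j - 2^-1 ^+ (i + j)).
  elim: i => [|i IH]; first by rewrite !subrr cnorm0 mulr0.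
  apply: le_trans (cnorm_triangle _ (sval (u (i + j)%N)) _) _.
  by have := uC (i + j)%N; rewrite addSn half_exp; nra.
have tail' j n : (j <= n)%N -> cnorm (sval (u n) - sval (u j)) <= 2 * C * 2^-1 ^+ j.
  move=> jn; rewrite -(subnK jn); apply: le_trans (tail _ _) _.
  by have := half_exp_gt0 (n - j + j); nra.
have [|c cP] := @cnorm_complete R A (fun j => sval (u j)).
  move=> e e0; have CC : 0 < 4 * C + 1 by lra.
  have [|N Ne] := @half_exp_lt (e / (4 * C + 1)); first by rewrite divr_gt0.
  exists N => m n Nm Nn; apply: le_lt_trans (cnorm_triangle _ (sval (u N)) _) _.
  have := tail' N m Nm; have := tail' N n Nn; rewrite (cnorm_subC _ (sval (u N))).
  by move: Ne; rewrite ltr_pdivlMr//; have := half_exp_gt0 N; nra.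
have uc j e : 0 < e -> cnorm (sval (u j) - c) <= 2 * C * 2^-1 ^+ j + e.
  move=> /cP[N uN]; have := uN (maxn N j) (leq_maxl _ _).
  have := tail' j (maxn N j) (leq_maxr _ _); rewrite cnorm_subC.
  by have := cnorm_triangle (sval (u j)) (sval (u (maxn N j))) c; lra.
have ck : cnorm c <= k%:R.
  apply/ler_addgt0Pl => e /cP[N /(_ N (leqnn N)) uN].
  have := cnormD (sval (u N)) (c - sval (u N)); rewrite addrC subrK cnorm_subC.
  by move: uN; case: (u N) => y /= yk; lra.
by exists (mkball ck) => j; apply/ler_addgt0Pr => e /(uc j).
Qed.

End CStarStructures.

(** * Separability of C(P) *)

Section Separable.
Context (R : realType) (P : continuumType) (d : P -> P -> R).
Context (dM : metric_of d) (ch : chainable P).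
Local Notation CP := (contC R P : cstarType R).

Let sort_of (n : nat) : ball_sort := @BallSort n.+1 isT.

Lemma rational_approx (c : R[i]) (e : R) : 0 < e -> exists q : rat * rat,
  normc (c - (ratr q.1 +i* ratr q.2)) < e.
Proof.
move=> e0; case: c => a b.
have [q1 /[!in_itv]/= q1a] := @rat_in_itvoo R (a - e / 2) (a + e / 2) ltac:(lra).
have [q2 /[!in_itv]/= q2b] := @rat_in_itvoo R (b - e / 2) (b + e / 2) ltac:(lra).
exists (q1, q2); suff : normc ((a - ratr q1) +i* (b - ratr q2)) < e by [].
apply: le_lt_trans (normc_le _) _ => /=.
have h (x q : R) : x - e / 2 < q < x + e / 2 -> `|x - q| < e / 2 by rewrite ltr_norml; lra.
by rewrite (splitr e) ltrD// h.
Qed.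

(** The countable index consists of a sort, a chain, rational values on its links and a precision.
    The element is not built: any element of the ball that close to the step function is chosen, if
    there is one. For suitable data [y] itself shows that there is one. *)
Lemma dense_sequence : exists (s : nat -> ball_sort) (a : forall i, cball CP (s i)),
  forall j (y : cball CP j) (e : R), 0 < e ->
    exists i, s i = j /\ cnorm (sval (a i) - sval y) < e.
Proof.
have kn n : exists Mk : nat * (P -> nat), onto_upto Mk.1 Mk.2 /\ mesh d Mk.2 (2^-1 ^+ n).
  by have [M [k [_ ? ?]]] := fine_chain dM ch (@half_exp_gt0 R n); exists (M, k).
have [Mk MkP] := choice kn.
pose I := (nat * nat * seq (rat * rat) * nat)%type.
pose W (w : seq (rat * rat)) i : R[i] :=
  ratr (nth (0, 0) w i).1 +i* ratr (nth (0, 0) w i).2.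
pose Q (i : I) (f : cball CP (sort_of i.1.1.1)) :=
  forall x, normc (ev f x - W i.1.2 ((Mk i.1.1.2).2 x)) <= 2^-1 ^+ i.2.
have fP (i : I) : exists f, (exists g, Q i g) -> Q i f.
  have [[g Qg]|nQ] := pselect (exists g, Q i g); first by exists g.
  by have [f _] := cball_inhabited CP (sort_of i.1.1.1); exists f.
pose idx (m : nat) : I := odflt (0%N, 0%N, [::], 0%N) (unpickle m).
exists (fun m => sort_of (idx m).1.1.1), (fun m => projT1 (cid (fP (idx m)))).
move=> j y e e0.
have [t tj] : exists t, sort_of t = j.
  by case: j y => -[//|t] h _; exists t; congr BallSort; exact: bool_irrelevance.
subst j.
have [p pe] := @half_exp_lt R (e / 2) ltac:(lra).
have p0 : 0 < 2^-1 ^+ p / 2 :> R by rewrite divr_gt0 ?half_exp_gt0.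
have [h h0 yh] := ev_unif_cont dM y p0.
have [n nh] := half_exp_lt h0.
have [[kM kon] km] := MkP n; set k := (Mk n).2 in kM kon km; set M := (Mk n).1 in kM kon.
have [xs xsP] : exists xs : nat -> P, forall i, (i <= M)%N -> k (xs i) = i.
  suff h' i : exists x, (i <= M)%N -> k x = i by have [xs xsP] := choice h'; exists xs.
  by have [/kon[x kx]|//] := leqP i M; [exists x | exists point].
have [q qP] := choice (fun i => rational_approx (ev y (xs i)) p0).
have yQ : Q (t, n, mkseq q M.+1, p) y.
  move=> x; rewrite /W nth_mkseq ?ltnS ?kM//=.
  apply: le_trans (normc_triangle _ (ev y (xs (k x))) _) _.
  rewrite (splitr (2^-1 ^+ p)) lerD// ltW// yh// (lt_trans _ nh)//.
  by apply: km; rewrite -/k xsP.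
exists (pickle (t, n, mkseq q M.+1, p)).
have : idx (pickle (t, n, mkseq q M.+1, p)) = (t, n, mkseq q M.+1, p).
  by rewrite /idx pickleK.
move: (idx _) => i -> {i}; split=> //.
case: cid => f /= fQ; have {}fQ := fQ (ex_intro _ y yQ).
apply: (@le_lt_trans _ _ (2^-1 ^+ p + 2^-1 ^+ p)); last by lra.
apply: cnorm_le_ev => x; apply: le_trans (normc_triangle _ (W (mkseq q M.+1) (k x)) _) _.
by apply: lerD; [exact: fQ | rewrite normc_subC; exact: yQ].
Qed.

End Separable.

(** * Construction of the embedding *)

Section SequenceContexts.
Context (R : realType) (s : nat -> ball_sort).

Fixpoint ctx (n : nat) : seq ball_sort := if n is n'.+1 then s n' :: ctx n' else [::].

Fixpoint tuple_env (A : cstarType R) (a : forall i, cball A (s i)) (n : nat) : env A (ctx n) :=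
  match n return env A (ctx n) with
  | 0%N => tt
  | n'.+1 => (a n', tuple_env a n')
  end.

(** The inclusions of contexts as a predicate: no proof of [m <= n] and no cast along an equation of
    lengths has to be carried. *)
Inductive extension (m : nat) : forall n, renaming (ctx m) (ctx n) -> Prop :=
| ext_refl : @extension m m (fun _ w => w)
| ext_step n (f : renaming (ctx m) (ctx n)) : extension f ->
    @extension m n.+1 (fun k w => varS (s n) (f k w)).

Lemma lookup_extension (A : cstarType R) (a : forall i, cball A (s i)) m n
    (f : renaming (ctx m) (ctx n)) k (w : var (ctx m) k) : extension f ->
  lookup (f k w) (tuple_env a n) = lookup w (tuple_env a m).
Proof. by elim. Qed.

Lemma extension_varS m n (f : renaming (ctx m.+1) (ctx n)) : extension f ->
  @extension m n (fun k w => f k (varS (s m) w)).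
Proof.
elim=> [|p g _ IH]; last exact: ext_step IH.
exact: ext_step (ext_refl m).
Qed.

Fixpoint weaken (m i : nat) : renaming (ctx m) (ctx (i + m)) :=
  match i return renaming (ctx m) (ctx (i + m)) with
  | 0%N => fun k w => w
  | i'.+1 => fun k w => varS (s (i' + m)) (@weaken m i' k w)
  end.

(** Every inclusion is some [weaken m i]; stating this as an elimination rule avoids transport along
    [n = i + m]. *)
Lemma extension_weaken m n (f : renaming (ctx m) (ctx n)) : extension f ->
  forall Q : (forall n, renaming (ctx m) (ctx n) -> Prop),
  (forall i, Q _ (@weaken m i)) -> Q n f.
Proof.
elim=> [|p g _ IH] Q Qw; first exact: Qw 0%N.
apply: (IH (fun n h => Q n.+1 (fun k w => varS (s n) (h k w)))) => i.
exact: Qw i.+1.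
Qed.

Lemma extension_exists m n : (m <= n)%N -> exists f : renaming (ctx m) (ctx n), extension f.
Proof.
elim: n => [|n IH]; first by rewrite leqn0 => /eqP->; exists (fun _ w => w); exact: ext_refl.
rewrite leq_eqVlt => /orP[/eqP->|/IH[f fE]]; first by exists (fun _ w => w); exact: ext_refl.
by exists (fun k w => varS (s n) (f k w)); exact: ext_step fE.
Qed.

Definition preserved (A B : cstarType R) (a : forall i, cball A (s i))
    (c : forall i, cball B (s i)) :=
  forall m (p : formula R (ctx m)), formula_val p (tuple_env c m) = formula_val p (tuple_env a m).

End SequenceContexts.

Section Extend.
Context (R : realType) (A B : cstarType R) (s : nat -> ball_sort).
Context (a : forall i, cball A (s i)) (c : forall i, cball B (s i)).
Context (a_dense : forall j (y : cball A j) (e : R), 0 < e ->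
    exists i, s i = j /\ cnorm (sval (a i) - sval y) < e).
Context (ac : preserved a c).

Lemma preserved_dist m n k (w : var (ctx s m) k) (w' : var (ctx s n) k) :
  cnorm (sval (lookup w (tuple_env c m)) - sval (lookup w' (tuple_env c n))) =
  cnorm (sval (lookup w (tuple_env a m)) - sval (lookup w' (tuple_env a n))).
Proof.
have [f fE] := extension_exists s (leq_maxl m n); have [g gE] := extension_exists s (leq_maxr m n).
have := ac (fDist (tVar R (f k w)) (tVar R (g k w'))) => /=.
by rewrite !lookup_extension.
Qed.

(** The closure of the graph sending each [a i] to [c i]. Entries are named by variables of sort [k]
    instead of indices [i] with [s i = k], which would need transport. *)
Definition corresponds k (x : cball A k) (y : cball B k) := forall e : R, 0 < e ->
  exists n (w : var (ctx s n) k), cnorm (sval (lookup w (tuple_env a n)) - sval x) < e /\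
    cnorm (sval (lookup w (tuple_env c n)) - sval y) < e.

Lemma corresponds_total k (x : cball A k) : exists y, corresponds x y.
Proof.
have near_x (p : nat) : exists nw : {n : nat & var (ctx s n) k},
    cnorm (sval (lookup (projT2 nw) (tuple_env a (projT1 nw))) - sval x) < 2^-1 ^+ p.
  have [i [ik ix]] := a_dense x (half_exp_gt0 R p).
  by subst k; exists (existT _ i.+1 (var0 (ctx s i) (s i))).
have [nw nwP] := choice near_x.
pose u p := lookup (projT2 (nw p)) (tuple_env c (projT1 (nw p))).
(* Consecutive terms differ by at most [2^-j + 2^-(j+1)], so the constant 2 suffices. The limit is
   then within [4 * 2^-p] of [u p], whence the [e / 5] below. *)
have [|y uy] := @geometric_limit R B k u 2.
  move=> j; rewrite preserved_dist; apply: le_trans (cnorm_triangle _ (sval x) _) _.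
  have := nwP j; have := nwP j.+1; rewrite half_exp (cnorm_subC (sval x)).
  by have := half_exp_gt0 R j; lra.
exists y => e e0; have e40 : 0 < e / 5 by rewrite divr_gt0.
have [p pe] := half_exp_lt e40.
exists (projT1 (nw p)), (projT2 (nw p)); split; first by have := nwP p; lra.
by have := uy p; rewrite -/(u p); lra.
Qed.

Lemma corresponds_env (h : forall k, cball A k -> cball B k) :
  (forall k x, corresponds x (h k x)) -> forall G (r : env A G) (e : R), 0 < e ->
  exists n (f : renaming G (ctx s n)), env_close e (pull f (tuple_env a n)) r /\
    env_close e (pull f (tuple_env c n)) (map_env h r).
Proof.
move=> hc G r e e0; elim: G r => [|k G IH] r.
  by exists 0%N, (fun k v => v); split=> k v; inversion v.
have [n [f [fa fc]]] := IH r.2; have [m [w [wa wc]]] := hc _ r.1 e e0.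
have [g gE] := extension_exists s (leq_maxl m n).
have [g' gE'] := extension_exists s (leq_maxr m n).
have [F [F0 FS]] : exists F : renaming (k :: G) (ctx s (maxn m n)),
    F k (var0 G k) = g k w /\ forall l v, F l (varS k v) = g' l (f l v).
  exists (fun l (v : var (k :: G) l) => match v in var G0 l0 return
      (match G0 with
       | [::] => unit
       | k0 :: G1 => var (ctx s (maxn m n)) k0 -> renaming G1 (ctx s (maxn m n)) ->
          var (ctx s (maxn m n)) l0 end)
    with
    | var0 G1 k1 => fun w0 _ => w0
    | varS G1 k1 l1 v' => fun _ f0 => f0 l1 v'
    end (g k w) (fun l v => g' l (f l v))).
  by [].
exists (maxn m n), F; split=> l v; move: l v; apply: var_case => [|l v].
- by rewrite lookup_pull F0 lookup_extension//= ltW.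
- by have := fa l v; rewrite !lookup_pull FS lookup_extension.
- by rewrite lookup_pull F0 lookup_extension//= ltW.
- by have := fc l v; rewrite !lookup_pull FS lookup_extension.
Qed.

(** Any choice of corresponding elements works: formulas are uniformly continuous in both algebras,
    and a finite tuple together with its image is approximated by entries of one common stage. *)
Lemma extend_preserved : exists h : forall k, cball A k -> cball B k, elementary_embedding h.
Proof.
exists (fun k x => projT1 (cid (corresponds_total x))) => G p r.
set h := fun k x => _; have hc k x : corresponds x (h k x) by rewrite /h; case: cid.
apply/eqP; rewrite -subr_eq0 -normr_le0; apply/ler_addgt0Pr => e e0; rewrite add0r.
have e20 : 0 < e / 2 by rewrite divr_gt0.
have [z z0 pz] := @formula_unif_cont R A G p _ e20.
have [z' z'0 pz'] := @formula_unif_cont R B G p _ e20.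
have zz0 : 0 < Num.min z z' by rewrite lt_min z0.
have [n [f [fa fc]]] := corresponds_env hc r zz0.
have h1 : `|formula_val p (pull f (tuple_env a n)) - formula_val p r| <= e / 2.
  by apply: pz => l v; apply: le_trans (fa l v) _; rewrite ge_min lexx.
have h2 : `|formula_val p (pull f (tuple_env c n)) - formula_val p (map_env h r)| <= e / 2.
  by apply: pz' => l v; apply: le_trans (fc l v) _; rewrite ge_min lexx orbT.
have [q qP] := rename_formula p f.
move: h1 h2; rewrite -!qP ac; rewrite !ler_norml; lra.
Qed.

End Extend.

(** * Isolating formulas for a sequence in C(P) and its copy in an equivalent algebra *)

Section PrimeModel.
Context (R : realType) (P : continuumType) (d : P -> P -> R).
Context (dM : metric_of d) (hi : hereditarily_indecomposable P) (ch : chainable P).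
Context (nondeg : exists x y : P, x <> y).
Local Notation CP := (contC R P : cstarType R).
Context (s : nat -> ball_sort) (a : forall i, cball CP (s i)).
Local Notation ctx := (ctx s).
Local Notation zeta n := (2^-1 ^+ n : R).

(* The constants leave room for the factor 4 lost in [realize_walk] and for the factor 16
   lost in [pattern_formula]. *)
Record stage (n : nat) := Stage {
  st_size : nat;
  st_index : P -> nat;
  st_walk : forall l, var (ctx n) l -> nat -> R[i];
  st_size_ge3 : (3 <= st_size)%N;
  st_pattern : pattern d (zeta n / 64) st_size st_walk st_index (tuple_env a n);
  st_bound : forall l (w : var (ctx n) l) i, normc (st_walk w i) <= l%:R
}.

Definition linked n (S : stage n) (S' : stage n.+1) :=
  forall (r : env CP (ctx n)) k, pattern d (zeta n) (st_size S) (st_walk S) k r ->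
  exists k', [/\ coarse d k', onto_upto (st_size S') k'
    & forall l (w : var (ctx n) l) x,
        normc (ev (lookup w r) x - st_walk S' (varS (s n) w) (k' x)) <= 7 * zeta n].

(** Nondegeneracy enters here: a chain of mesh half the distance of two points has at least four
    links, which starts the invariant [3 <= st_size]. *)
Lemma first_stage : exists S : stage 0, True.
Proof.
have [x [y xy]] := nondeg.
have dxy : 0 < d x y.
  by rewrite lt_neqAle (dist_ge0 dM) andbT eq_sym; apply/eqP => /(dist_eq0 dM).
have [M [k [kc kon km]]] := @fine_chain R P d dM (d x y / 2) ch ltac:(lra).
have M3 : (3 <= M)%N.
  have [kM kon'] := kon; rewrite leqNgt; apply/negP => M2.
  have [b bE] := kon' (minn M 1) (geq_minl _ _).
  have := kM x; have := kM y => ? ?.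
  have xb : d x b < d x y / 2 by apply: km; nat_lia.
  have yb : d b y < d x y / 2 by apply: km; nat_lia.
  by have := dist_triangle dM x b y; lra.
have kpat : pattern d (zeta 0 / 64) M (fun l (w : var (ctx 0) l) i => 0) k (tuple_env a 0).
  by split=> // j w; inversion w.
have kb l (w : var (ctx 0) l) (i : nat) : normc (0 : R[i]) <= l%:R by inversion w.
by exists (Stage M3 kpat kb).
Qed.

Lemma next_stage n (S : stage n) : exists S' : stage n.+1, linked S S'.
Proof.
have z0 : 0 < zeta n.+1 / 64 by rewrite divr_gt0 ?half_exp_gt0.
case: (S) => N k v N3 kpat vb; have [kc kon _ _] := kpat.
have [M [k2 [v2 [M3 k2pat v2b k2P]]]] :=
  refine_pattern dM hi ch (a n) (tuple_env a n) z0 N3 kc kon.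
exists (Stage (n := n.+1) M3 k2pat v2b) => r k' k'pat.
apply: k2P k'pat; apply: pattern_le kpat.
by have := half_exp_gt0 R n; lra.
Qed.

Let first : stage 0 := projT1 (cid first_stage).
Fixpoint stages (n : nat) : stage n :=
  if n is n'.+1 then projT1 (cid (next_stage (stages n'))) else first.

Lemma stages_linked n : linked (stages n) (stages n.+1).
Proof. by rewrite /=; case: cid. Qed.

Lemma approx_formula n : exists X : formula R (ctx n),
  (forall r : env CP (ctx n), formula_val X r < 1 ->
     exists k, pattern d (zeta n) (st_size (stages n)) (st_walk (stages n)) k r) /\
  (forall (r : env CP (ctx n)) k, coarse d k -> onto_upto (st_size (stages n)) k ->
     (forall l (w : var (ctx n) l) x,
        normc (ev (lookup w r) x - st_walk (stages n) w (k x)) <= zeta n / 16) ->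
     formula_val X r <= 0).
Proof.
case: (stages n) => N k v N3 [kc kon vs kr] vb /=.
apply: (pattern_formula vb dM) => //.
- by nat_lia.
- by move=> j w i iN; apply: le_trans (vs j w i iN) _; have := half_exp_gt0 R n; lra.
Qed.

Definition approx n : formula R (ctx n) := projT1 (cid (approx_formula n)).

Lemma approx_pattern n (r : env CP (ctx n)) : formula_val (approx n) r < 1 ->
  exists k, pattern d (zeta n) (st_size (stages n)) (st_walk (stages n)) k r.
Proof. by rewrite /approx; case: cid => X [XP ?] /= /XP. Qed.

Lemma pattern_approx n (r : env CP (ctx n)) k : coarse d k ->
  onto_upto (st_size (stages n)) k ->
  (forall l (w : var (ctx n) l) x,
     normc (ev (lookup w r) x - st_walk (stages n) w (k x)) <= zeta n / 16) ->
  formula_val (approx n) r <= 0.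
Proof. by rewrite /approx; case: cid => X [? XP] /=; exact: XP. Qed.

Lemma approx_tuple n : formula_val (approx n) (tuple_env a n) <= 0.
Proof.
have [kc kon _ kr] := st_pattern (stages n).
apply: (pattern_approx kc kon) => l w x; apply: le_trans (kr l w x) _.
by have := half_exp_gt0 R n; lra.
Qed.

(** All entries of [t], old and new, are realized afresh from the next walk, so that the strong
    threshold [<= 0] is regained. The price is that the old entries move, by [7 * zeta n] for the
    reindexing plus the small error of realization. *)
Lemma approx_step n (r : env CP (ctx n)) : formula_val (approx n) r < 1 ->
  exists t : env CP (ctx n.+1), formula_val (approx n.+1) t <= 0 /\
    forall l (w : var (ctx n) l),
      cnorm (sval (lookup (varS (s n) w) t) - sval (lookup w r)) <= 8 * zeta n.
Proof.
move=> /approx_pattern[k kr]; have [k' [k'c k'on k'r]] := stages_linked kr.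
have z0 := half_exp_gt0 R n.
have [_ _ vs _] := st_pattern (stages n.+1); have vb := @st_bound _ (stages n.+1).
have z64 : 0 <= zeta n.+1 / 64 by rewrite divr_ge0// ltW// half_exp_gt0.
have fP l (w : var (ctx n.+1) l) := realize_walk dM z64 k'c k'on (vb l w) (vs l w).
pose t : env CP (ctx n.+1) := mkenv (fun l w => projT1 (cid (fP l w))).
have tP l (w : var (ctx n.+1) l) x :
    normc (ev (lookup w t) x - st_walk (stages n.+1) w (k' x)) <= 4 * (zeta n.+1 / 64).
  by rewrite lookup_mkenv; case: cid.
exists t; split.
  apply: (pattern_approx k'c k'on) => l w x; apply: le_trans (tP l w x) _.
  by lra.
move=> l w; apply: cnorm_le_ev => x.
have := tP l (varS (s n) w) x; have := k'r l w x.
have := normc_triangle (ev (lookup (varS (s n) w) t) x)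
  (st_walk (stages n.+1) (varS (s n) w) (k' x)) (ev (lookup w r) x).
rewrite (normc_subC (st_walk _ _ _)) half_exp.
rewrite -[contC_fun _ x]/(ev (lookup (varS (s n) w) t) x - ev (lookup w r) x).
by lra.
Qed.

(** This is atomicity: for large [n], the condition [approx n < 1] alone determines the value of [p]
    on the first [m] entries up to [e]. *)
Lemma approx_type m (p : formula R (ctx m)) (e : R) : 0 < e -> exists n0, forall n
    (f : renaming (ctx m) (ctx n)), (n0 <= n)%N -> extension f ->
  forall r : env CP (ctx n), formula_val (approx n) r < 1 ->
    `|formula_val p (pull f r) - formula_val p (tuple_env a m)| <= e.
Proof.
move=> e0; have [z z0 pz] := formula_pattern dM hi ch p e0.
have [n0 n0z] := half_exp_lt z0; exists n0 => n f n0n fE r /approx_pattern[k kr].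
apply: pz; exists (st_size (stages n)), (fun l w => st_walk (stages n) (f l w)), k,
  (st_index (stages n)).
have nz : zeta n <= z by apply: le_trans (ltW n0z); exact: half_exp_le.
split; first exact: st_size_ge3.
- have [kc kon vs rv] := pattern_le nz kr; split=> // [j w i|j w x]; first exact: vs.
  by rewrite lookup_pull.
- have nz' : zeta n / 64 <= z by have := half_exp_gt0 R n; lra.
  have [kc kon vs rv] := pattern_le nz' (st_pattern (stages n)); split=> // [j w i|j w x].
    exact: vs.
  by rewrite -(lookup_extension a w fE).
Qed.

Context (B : cstarType R) (AB : elementarily_equivalent CP B).

(** The hypothesis on [r] stands under the existential quantifier, so that [other] can be defined by
    plain recursion. The scaled distance minus 1 is at most 0 within [8 * zeta n]; as the infimum
    need not be attained, only a value below 1 is available in [B], which doubles the distance to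
    [16 * zeta n]. *)
Lemma other_step n (r : env B (ctx n)) : exists t : env B (ctx n.+1),
  formula_val (approx n) r < 1 -> formula_val (approx n.+1) t < 1 /\
    forall l (w : var (ctx n) l),
      cnorm (sval (lookup (varS (s n) w) t) - sval (lookup w r)) <= 16 * zeta n.
Proof.
have z0 := half_exp_gt0 R n.
have [X' X'P] := rename_formula (approx n.+1) (fun k v => @varl (ctx n) (ctx n.+1) k v).
pose q := fInfs (fMax X' (@fAllV R _ (ctx n) (fun l w =>
  fAffine (8 * zeta n)^-1 (-1)
    (fDist (tVar R (varl (ctx n) (varS (s n) w))) (tVar R (varr (ctx n.+1) w)))))).
have key : forall u : env B (ctx n), formula_val (approx n) u < 1 -> formula_val q u <= 0.
  apply: (transfer AB) => u /approx_step[t [tX tu]].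
  apply: le_trans (fInfs_le _ t u) _; apply: fMax_le; first by rewrite X'P pull_varl.
  apply: fAllV_le => l w; rewrite fAffineE.
  have := tu l w; rewrite fDist_varE => tw.
  by rewrite subr_le0 mulrC ler_pdivrMr ?mul1r// mulr_gt0.
have [rX|rX] := ltP (formula_val (approx n) r) 1; last first.
  have [t _] : exists t : env B (ctx n.+1), True.
    exists (mkenv (fun k _ => projT1 (cid (cball_inhabited B k)))); exact: I.
  by exists t.
have /fInfs_lt[t /fMax_lt[tX tr]] : formula_val q r < 1 by have := key r rX; lra.
exists t => _; split; first by move: tX; rewrite X'P pull_varl.
move=> l w; move/fAllV_lt/(_ l w): tr; rewrite fAffineE.
rewrite fDist_varE => tw.
have z8 : 0 < 8 * zeta n by rewrite mulr_gt0.
have : (8 * zeta n)^-1 * cnorm (sval (lookup (varS (s n) w) t) - sval (lookup w r)) < 2 by lra.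
by rewrite mulrC ltr_pdivrMr//; lra.
Qed.

Fixpoint other (n : nat) : env B (ctx n) :=
  match n return env B (ctx n) with
  | 0%N => tt
  | n'.+1 => projT1 (cid (other_step (other n')))
  end.

Lemma other_approx n : formula_val (approx n) (other n) < 1.
Proof.
elim: n => [|n IH]; last by rewrite /=; case: cid => t /= /(_ IH)[].
(* At stage 0 the formula is a sentence, so elementary equivalence applies directly. *)
rewrite -[other 0]/tt -(AB (approx 0)).
by apply: le_lt_trans ltr01; exact: (approx_tuple 0).
Qed.

Lemma other_close n l (w : var (ctx n) l) :
  cnorm (sval (lookup (varS (s n) w) (other n.+1)) - sval (lookup w (other n))) <= 16 * zeta n.
Proof. by rewrite [other n.+1]/=; case: cid => t /= /(_ (other_approx n))[_]; apply. Qed.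

(** Entry [i] is moved at every later stage; the moves [16 * zeta n] are summable, with tail
    [32 * zeta n]. *)
Lemma other_limit i : exists c : cball B (s i), forall n (f : renaming (ctx i.+1) (ctx n)),
  extension f -> cnorm (sval (lookup (f _ (var0 (ctx i) (s i))) (other n)) - sval c) <= 32 * zeta n.
Proof.
pose u j := lookup (@weaken s i.+1 j _ (var0 (ctx i) (s i))) (other (j + i.+1)).
have [|c uc] := @geometric_limit R B (s i) u (16 * zeta i.+1).
  move=> j; rewrite -mulrA -exprD addnC; exact: other_close.
exists c => n f fE.
apply: (extension_weaken fE (Q := fun n f =>
  cnorm (sval (lookup (f _ (var0 (ctx i) (s i))) (other n)) - sval c) <= 32 * zeta n)) => j.
apply: le_trans (uc j) _; rewrite exprD.
by have := half_exp_gt0 R i.+1; have := half_exp_gt0 R j; nra.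
Qed.

Definition limit i : cball B (s i) := projT1 (cid (other_limit i)).

Lemma limit_close m n (f : renaming (ctx m) (ctx n)) : extension f ->
  env_close (32 * zeta n) (pull f (other n)) (tuple_env limit m).
Proof.
elim: m f => [|m IH] f fE l w; first by inversion w.
rewrite lookup_pull; move: l w; apply: var_case => [|l w] /=.
  by rewrite /limit; case: cid => c /= cP; exact: cP fE.
by have := IH _ (extension_varS fE) l w; rewrite lookup_pull.
Qed.

(** At a late stage the limits are close to the entries of [other n], which costs [e / 2] by uniform
    continuity in [B]. The other [e / 2] comes from [approx_type], an implication from [< 1] to
    [<= 0] and hence transferable to [B]. *)
Lemma limit_preserved : preserved a limit.
Proof.
move=> m p; apply/eqP; rewrite -subr_eq0 -normr_le0; apply/ler_addgt0Pr => e e0.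
rewrite add0r; have e20 : 0 < e / 2 by rewrite divr_gt0.
have [z z0 pz] := @formula_unif_cont R B _ p _ e20.
have [n0 n0P] := approx_type p e20.
have [n1 n1z] := @half_exp_lt R (z / 32) ltac:(by rewrite divr_gt0).
pose n := (maxn m (maxn n0 n1)).
have [f fE] := @extension_exists s m n (leq_maxl _ _).
have n0n : (n0 <= n)%N by rewrite /n; lia.
have n1n : (n1 <= n)%N by rewrite /n; lia.
have h1 : `|formula_val p (pull f (other n)) - formula_val p (tuple_env limit m)| <= e / 2.
  apply: pz => l w; apply: le_trans (limit_close fE w) _.
  by have := half_exp_le R n1n; lra.
have [q qP] := rename_formula p f.
set c := formula_val p (tuple_env a m).
have key (r : env CP (ctx n)) : formula_val (approx n) r < 1 ->
    formula_val (fMax (fAffine 1 (- c - e / 2) q) (fAffine (-1) (c - e / 2) q)) r <= 0.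
  move=> /(n0P n f n0n fE); rewrite -qP ler_norml -/c => /andP[h2 h3].
  by apply: fMax_le; rewrite fAffineE; lra.
have := transfer AB key (other_approx n); rewrite fMaxE ge_max !fAffineE qP => /andP[h2 h3].
by move: h1; rewrite !ler_norml; lra.
Qed.

End PrimeModel.

Theorem corollary4p4 (R : realType) (P : continuumType) (hP : pseudoarc R P)
    (B : cstarType R) (hB : elementarily_equivalent (contC R P : cstarType R) B) :
  exists h : forall k : ball_sort, cball (contC R P : cstarType R) k -> cball B k,
    elementary_embedding h.
Proof.
have [[d [d0 dsym dtri dnbhs]] nondeg hi ch] := hP.
have dM : metric_of d by [].
have [s [a a_dense]] := dense_sequence dM ch.
exact (extend_preserved a_dense (limit_preserved dM hi ch nondeg a hB)).
Qed.
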